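(* Let $Q\ge 1$ and let $(X,d,\mu)$ be a proper metric measure space that is locally $Q$-homogeneous and supports a local $Q$-Poincaré inequality. Let $(Y,d_Y)$ be any metric space and let $p>Q$. If $f\colon X\to Y$ is a continuous mapping that has an upper gradient in $L^p_{\mathrm{loc}}(X)$, then for every subset $E\subseteq X$, $$\dim_Y f(E)\le \frac{p\,\dim_X E}{p-Q+\dim_X E}.$$ Moreover, if $\mathcal{H}^Q_X(E)=0$, then $\mathcal{H}^Q_Y(f(E))=0$.
   Context: A metric measure space $(X,d,\mu)$ is a metric space with a Borel measure $\mu$ giving positive and finite measure to every nonempty open set. It is proper if every closed ball is compact. $B(x,r)=\{y:d(x,y)<r\}$. $\mathcal{H}^t_Z$ denotes $t$-dimensional Hausdorff measure in a metric space $Z$, and $\dim_Z A$ the Hausdorff dimension of $A\subseteq Z$ with the restricted metric. $(X,d,\mu)$ is locally $Q$-homogeneous if for every compact $K\subseteq X$ there are $R>0$ and $C\ge1$ such that $\mu(B(x,r_2))/r_2^Q\le C\,\mu(B(x,r_1))/r_1^Q$ whenever $x\in K$ and $0<r_1\le r_2< R$. For a continuous map $f\colon X\to Y$, a Borel function $g\colon X\to[0,\infty]$ is an upper gradient of $f$ if $d_Y(f(\gamma(0)),f(\gamma(1)))\le\int_\gamma g\,ds$ for every rectifiable curve $\gamma\colon[0,1]\to X$. $(X,d,\mu)$ supports a local $p$-Poincaré inequality ($p\ge1$) if for every compact $K\subseteq X$ there are constants $C\ge1$, $\sigma\ge1$, $R>0$ such that for every continuous $u\colon X\to\mathbb{R}$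 and every upper gradient $g$ of $u$, $\frac{1}{\mu(B)}\int_B|u-u_B|\,d\mu\le C\operatorname{diam}B\left(\frac{1}{\mu(\sigma B)}\int_{\sigma B}g^p\,d\mu\right)^{1/p}$ for every open ball $B$ centered in $K$ of radius less than $R$, where $u_B$ is the $\mu$-average of $u$ on $B$ and $\sigma B(x,r)=B(x,\sigma r)$. *)

(* Defs.v *)
From HB Require Import structures.
From mathcomp Require Import all_boot all_order all_algebra.
From mathcomp Require Import all_classical all_reals all_analysis measurable_realfun.
Set Implicit Arguments. Unset Strict Implicit. Unset Printing Implicit Defensive.
Import Order.TTheory GRing.Theory Num.Theory.
Import numFieldNormedType.Exports.
Local Open Scope classical_set_scope.
Local Open Scope ring_scope.

Section MetricNotions.
Context {R : realType}.

Definition is_metric (Z : Type) (d : Z -> Z -> R) : Prop :=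
  (forall x y, 0 <= d x y) /\ (forall x y, d x y = 0 <-> x = y) /\
  (forall x y, d x y = d y x) /\ (forall x y z, d x z <= d x y + d y z).

Definition oball (Z : Type) (d : Z -> Z -> R) (x : Z) (r : R) : set Z :=
  [set y | d x y < r].
Definition cball (Z : Type) (d : Z -> Z -> R) (x : Z) (r : R) : set Z :=
  [set y | d x y <= r].

Definition mopen (Z : Type) (d : Z -> Z -> R) (U : set Z) : Prop :=
  forall x, U x -> exists2 r : R, 0 < r & oball d x r `<=` U.

Definition mcompact (Z : Type) (d : Z -> Z -> R) (K : set Z) : Prop :=
  forall F : set (set Z), (forall U, F U -> mopen d U) ->
    K `<=` \bigcup_(U in F) U ->
    exists s : seq (set Z), (forall U, U \in s -> F U) /\
      K `<=` \bigcup_(U in [set U | U \in s]) U.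

Definition mproper (Z : Type) (d : Z -> Z -> R) : Prop :=
  forall x r, mcompact d (cball d x r).

Definition mcontinuous (Z W : Type) (dZ : Z -> Z -> R) (dW : W -> W -> R)
  (f : Z -> W) : Prop :=
  forall x (e : R), 0 < e -> exists2 del : R, 0 < del &
    forall y, dZ x y < del -> dW (f x) (f y) < e.

(** diameter, as an extended real (diam of the empty set is 0) *)
Definition diam (Z : Type) (d : Z -> Z -> R) (U : set Z) : \bar R :=
  ereal_sup ([set (d x y)%:E | x in U & y in U] `|` [set 0%E]).

(** Hausdorff content at scale delta and t-dimensional Hausdorff measure
    (without normalising constant) *)
Definition hausdorff_content (Z : Type) (d : Z -> Z -> R) (t del : R)
  (A : set Z) : \bar R :=
  ereal_inf [set (\sum_(0 <= i <oo) (poweR (diam d (U i)) t))%E |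
    U in [set U : nat -> set Z |
      A `<=` \bigcup_i U i /\ forall i, (diam d (U i) <= del%:E)%E]].

Definition hausdorff_measure (Z : Type) (d : Z -> Z -> R) (t : R)
  (A : set Z) : \bar R :=
  ereal_sup [set hausdorff_content d t del A | del in [set del : R | 0 < del]].

Definition hdim (Z : Type) (d : Z -> Z -> R) (A : set Z) : \bar R :=
  ereal_inf [set t%:E | t in [set t : R | 0 < t /\
    hausdorff_measure d t A = 0%E]].

(** Curves: gamma : R -> Z, only its restriction to [0,1] matters. *)
Definition curve_continuous (Z : Type) (d : Z -> Z -> R) (gam : R -> Z) : Prop :=
  forall t, 0 <= t <= 1 -> forall e : R, 0 < e -> exists2 del : R, 0 < del &
    forall s, 0 <= s <= 1 -> `|s - t| < del -> d (gam s) (gam t) < e.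

Definition curve_length (Z : Type) (d : Z -> Z -> R) (gam : R -> Z) (a b : R)
  : \bar R :=
  ereal_sup [set l | exists (n : nat) (tt : nat -> R),
    [/\ tt 0%N = a, tt n = b,
         (forall i, (i < n)%N -> tt i <= tt i.+1) &
         l = (\sum_(i < n) d (gam (tt i)) (gam (tt i.+1)))%:E]].

Definition rectifiable (Z : Type) (d : Z -> Z -> R) (gam : R -> Z) : Prop :=
  curve_continuous d gam /\ (curve_length d gam 0 1 < +oo)%E.

Definition arclength (Z : Type) (d : Z -> Z -> R) (gam : R -> Z) (t : R) : R :=
  fine (curve_length d gam 0 (Num.min 1 (Num.max 0 t))).

(** Line integral of g along a rectifiable gam: integral of g o gam over
    [0,1] against the Lebesgue-Stieltjes measure of the arc-length function
    F (F is required to be that function; it is continuous nondecreasing). *)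
Definition line_integral (Z : Type) (F : cumulative R R) (gam : R -> Z)
  (g : Z -> \bar R) : \bar R :=
  (\int[lebesgue_stieltjes_measure F]_(t in `[0%R, 1%R]) g (gam t))%E.

Definition upper_gradient (dz : measure_display) (Z : measurableType dz)
  (W : Type) (dZ : Z -> Z -> R) (dW : W -> W -> R) (f : Z -> W)
  (g : Z -> \bar R) : Prop :=
  measurable_fun [set: Z] g /\ (forall x, (0 <= g x)%E) /\
  forall gam : R -> Z, rectifiable dZ gam ->
    forall F : cumulative R R, (forall t, F t = arclength dZ gam t) ->
      ((dW (f (gam 0)) (f (gam 1)))%:E <= line_integral F gam g)%E.

Definition borel_for (dz : measure_display) (Z : measurableType dz)
  (d : Z -> Z -> R) : Prop :=
  (@measurable _ Z) = <<s [set U | mopen d U] >>.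

Definition mm_space (dz : measure_display) (Z : measurableType dz)
  (d : Z -> Z -> R) (mu : {measure set Z -> \bar R}) : Prop :=
  is_metric d /\ borel_for d /\
  forall U, mopen d U -> U !=set0 -> (0 < mu U /\ mu U < +oo)%E.

Definition loc_homogeneous (dz : measure_display) (Z : measurableType dz)
  (d : Z -> Z -> R) (mu : {measure set Z -> \bar R}) (Q : R) : Prop :=
  forall K, mcompact d K -> exists Rr C : R, 0 < Rr /\ 1 <= C /\
    forall x r1 r2, K x -> 0 < r1 -> r1 <= r2 -> r2 < Rr ->
      (mu (oball d x r2) * ((r2 `^ Q)^-1)%:E
        <= C%:E * (mu (oball d x r1) * ((r1 `^ Q)^-1)%:E))%E.

Definition maverage (dz : measure_display) (Z : measurableType dz)
  (mu : {measure set Z -> \bar R}) (B : set Z) (u : Z -> R) : R :=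
  (fine (mu B))^-1 * fine (\int[mu]_(y in B) (u y)%:E)%E.

Definition loc_poincare (dz : measure_display) (Z : measurableType dz)
  (d : Z -> Z -> R) (mu : {measure set Z -> \bar R}) (p : R) : Prop :=
  forall K, mcompact d K -> exists C sig Rr : R, 1 <= C /\ 1 <= sig /\ 0 < Rr /\
    forall (u : Z -> R) (g : Z -> \bar R),
      mcontinuous d (fun a b => `|a - b|) u ->
      upper_gradient d (fun a b => `|a - b|) u g ->
      forall x r, K x -> 0 < r -> r < Rr ->
        let B := oball d x r in
        let sB := oball d x (sig * r) in
        (((fine (mu B))^-1)%:E *
           \int[mu]_(y in B) (`|u y - maverage mu B u|)%:E
         <= C%:E * diam d B *
            poweR (((fine (mu sB))^-1)%:E * \int[mu]_(y in sB) poweR (g y) p)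
                  p^-1)%E.

Definition Lp_loc (dz : measure_display) (Z : measurableType dz)
  (d : Z -> Z -> R) (mu : {measure set Z -> \bar R}) (p : R)
  (g : Z -> \bar R) : Prop :=
  measurable_fun [set: Z] g /\
  forall K, mcompact d K -> (\int[mu]_(x in K) poweR (g x) p < +oo)%E.

(** right-hand side p s / (p - Q + s) of the dimension bound, for s = dim E;
    for s = +oo (which cannot occur here, since dim E <= Q) we use the limit p *)
Definition dim_bound (p Q : R) (s : \bar R) : \bar R :=
  match s with
  | r%:E => (p * r / (p - Q + r))%:E
  | +oo%E => p%:E
  | -oo%E => 0%E
  end.

End MetricNotions.

(* Main.v *)
(** A pointwise telescoping argument over dyadic balls turns the Poincare
    inequality into a Morrey-type estimate: if the average of g^p over the ball
    B(x, 2 sig r) is at most a^p, then f(B(x, r)) has diameter at most M r a.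

    Given a cover of E by balls B(x_i, r_i) with small sum of r_i^t, a Vitali
    selection makes the balls disjoint while the balls B(x_i, 5 r_i) still cover.
    Sort them by the level l, the least integer for which the energy density of the
    enlarged ball is at most 2^(l p).  A second Vitali selection inside each level
    gives the weak-type bound that the sum of r_i^Q over level l is O(2^(-l p)).
    Interpolating between this bound and the smallness of the sum of r_i^t, with
    weights tau and 1 - tau, the sum of (r_i 2^l)^alpha over level l is small and
    decays geometrically in l as soon as
    (1 - tau) t + tau Q <= alpha < p tau.  Both conclusions follow by choosing tau:
    t = alpha = Q and Q / p < tau < 1 for the null sets, and tau close to
    dim E / (p - Q + dim E) for the dimension bound. *)

Require Import Defs.
From HB Require Import structures.
From mathcomp Require Import all_boot all_order all_algebra.
From mathcomp Require Import all_classical all_reals all_analysis measurable_realfun.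
From mathcomp Require Import ring lra.
Import Order.TTheory GRing.Theory Num.Theory.
Local Open Scope classical_set_scope.
Local Open Scope ring_scope.

(** * Balls in a metric space and Vitali selection *)

Section MetricBasics.
Context {R : realType} {Z : Type} {d : Z -> Z -> R}.
Implicit Types (x y z : Z) (r s : R).

Lemma dist_ge0 : is_metric d -> forall x y, 0 <= d x y.
Proof. by case. Qed.

Lemma dist_refl : is_metric d -> forall x, d x x = 0.
Proof. by move=> [_ [h _]] x; apply/h. Qed.

Lemma dist_sym : is_metric d -> forall x y, d x y = d y x.
Proof. by move=> [_ [_ [h _]]]. Qed.

Lemma dist_triangle : is_metric d -> forall x y z, d x z <= d x y + d y z.
Proof. by move=> [_ [_ [_ h]]]. Qed.

Lemma sub_oball : is_metric d -> forall x y r s, d y x + r <= s ->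
  oball d x r `<=` oball d y s.
Proof.
move=> md x y r s h z; rewrite /oball /= => xz.
by have := dist_triangle md y x z; lra.
Qed.

Lemma mopen_oball : is_metric d -> forall x r, mopen d (oball d x r).
Proof.
move=> md x r y; rewrite /oball /= => xy.
exists (r - d x y); first by rewrite subr_gt0.
by apply: sub_oball => //; lra.
Qed.

Lemma mopen_setC_cball : is_metric d -> forall x r, mopen d (~` cball d x r).
Proof.
move=> md x r y; rewrite /cball /= => /negP; rewrite -ltNge => xy.
exists (d x y - r); first by rewrite subr_gt0.
move=> z; rewrite /oball /= => yz; apply/negP; rewrite -ltNge.
by have := dist_triangle md x z y; have := dist_sym md y z; lra.
Qed.

Lemma diam_oball_le : is_metric d -> forall x r, 0 <= r ->
  (diam d (oball d x r) <= (2 * r)%:E)%E.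
Proof.
move=> md x r r0; apply: ge_ereal_sup => _ [[y /= hy [z /= hz <-]]|->].
  rewrite lee_fin; move: hy hz; rewrite /oball /= => hy hz.
  by have := dist_triangle md y x z; have := dist_sym md y x; lra.
by rewrite lee_fin; lra.
Qed.

(* Maximality is taken among disjoint subfamilies J such that every ball meeting
   a member of J meets one of at least half its own radius. *)
Lemma vitali_cover (I : Type) (D : set I) (x : I -> Z) (r : I -> R) (M : R) :
  is_metric d -> (forall i, D i -> 0 < r i <= M) ->
  exists J : set I, [/\ J `<=` D,
    trivIset J (fun i => oball d (x i) (r i)) &
    forall i, D i -> exists2 j, J j &
      oball d (x i) (r i) `<=` oball d (x j) (5 * r j)].
Proof.
move=> md rM.
pose B i := oball d (x i) (r i).
pose P := [set J : set I | [/\ J `<=` D, trivIset J B &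
  forall i j, D i -> J j -> B i `&` B j !=set0 ->
    exists2 k, J k & r i <= 2 * r k /\ B i `&` B k !=set0]].
have [|J [[JD Jtriv Jhalf] Jmax]] := @Zorn_bigcup I P.
  move=> F FP Ftot; split.
  - by move=> i [J FJ Ji]; have [+ _ _] := FP _ FJ; apply.
  - move=> i j [J FJ Ji] [J' FJ' Jj].
    have [h|h] := Ftot _ _ FJ FJ'.
      by have [_ + _] := FP _ FJ'; apply=> //; exact: h.
    by have [_ + _] := FP _ FJ; apply=> //; exact: h.
  - move=> i j Di [J FJ Jj] ij.
    have [_ _ /(_ i j Di Jj ij)[k Jk hk]] := FP _ FJ.
    by exists k => //; exists J.
exists J; split=> // i Di.
have B_self k : D k -> B k (x k).
  by move=> /rM/andP[rk _]; rewrite /B /oball /= dist_refl.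
have [[j Jj [rij [z [iz jz]]]]|noJ] :=
  pselect (exists2 j, J j & r i <= 2 * r j /\ B i `&` B j !=set0).
  exists j => // w; move: iz jz; rewrite /B /oball /= => iz jz iw.
  have := dist_triangle md (x j) z w; have := dist_triangle md z (x i) w.
  by have := dist_sym md z (x i); lra.
exfalso.
(* [W] indexes the balls that miss all of [J]. A member whose radius exceeds half the supremum over
   [W] can be added to [J], against maximality. *)
pose W := [set k | D k /\ forall j, J j -> ~ (B k `&` B j !=set0)].
have Wi : W i.
  by split=> // j Jj ij; apply: noJ; exact: (Jhalf _ _ Di Jj ij).
have [k0 Wk0 k0max] : exists2 k0, W k0 & forall k, W k -> r k <= 2 * r k0.
  have sW : has_sup (r @` W).
    split; first by exists (r i), i.
    by exists M => _ [k [Dk _] <-]; case/andP: (rM _ Dk).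
  have sgt0 : 0 < sup (r @` W).
    have /andP[ri _] := rM _ Di; apply: (lt_le_trans ri).
    by apply: sup_upper_bound => //; exists i.
  have [|_ [k0 Wk0 <-] hk0] := @sup_adherent _ _ (sup (r @` W) / 2) _ sW.
    by rewrite divr_gt0.
  exists k0 => // k Wk.
  have : r k <= sup (r @` W) by apply: sup_upper_bound => //; exists k.
  by lra.
have [Dk0 k0J] := Wk0.
apply: (Jmax (J `|` [set k0])).
  split=> [w Jw|/(_ k0 (or_intror erefl)) Jk0]; first by left.
  by apply: (k0J _ Jk0); exists (x k0); split; exact: B_self.
split.
- by move=> k [/JD//|->].
- move=> a b [Ja|->] [Jb|->] // ab; first exact: Jtriv.
    by exfalso; apply: (k0J _ Ja); rewrite setIC.
  by exfalso; exact: (k0J _ Jb).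
- move=> a b Da Jb ab.
  (* A ball that meets the new member but none of [J] lies in [W], so its radius is at most twice
     that of [k0]. *)
  have [[c Jc ac]|noc] := pselect (exists2 c, J c & B a `&` B c !=set0).
    by have [k Jk hk] := Jhalf a c Da Jc ac; exists k => //; left.
  case: Jb ab => [Jb ab|-> ab]; first by exfalso; apply: noc; exists b.
  exists k0; first by right.
  split=> //; apply: k0max; split=> // j Jj aj.
  by apply: noc; exists j.
Qed.

End MetricBasics.

(** * Sets of Hausdorff measure zero *)

Lemma sum_half_le1 (R : realType) n : \sum_(i < n) (2^-1 : R) ^+ i.+1 <= 1.
Proof.
suff -> : \sum_(i < n) (2^-1 : R) ^+ i.+1 = 1 - 2^-1 ^+ n.
  by rewrite gerBl exprn_ge0.
elim: n => [|m IH]; first by rewrite big_ord0 expr0 subrr.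
by rewrite big_ord_recr /= IH exprS; lra.
Qed.

Section HausdorffNull.
Context {R : realType} {Z : Type} {d : Z -> Z -> R}.
Implicit Types (A : set Z) (t : R).

(* No bound on the diameters is needed: a small sum forces them to be small. *)
Definition hausdorff_null (t : R) A : Prop :=
  forall eta : R, 0 < eta -> exists (U : nat -> set Z) (rho : nat -> R),
    [/\ A `<=` \bigcup_i U i, forall i, 0 <= rho i,
        forall i x y, U i x -> U i y -> d x y <= rho i &
        forall n, \sum_(i < n) rho i `^ t <= eta].

Lemma diam_ge0 (U : set Z) : (0 <= diam d U)%E.
Proof. by apply: ereal_sup_ubound; right. Qed.

Lemma hausdorff_content_ge0 t (del : R) A :
  (0 <= hausdorff_content d t del A)%E.
Proof.
apply: le_ereal_inf_tmp => _ [U _ <-].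
by apply: nneseries_ge0 => n _ _; exact: poweR_ge0.
Qed.

(** From measure zero only the content at scale 1 is used. Conversely, since [t > 0], a sum of
    [t]-th powers that is at most [del^t] bounds every [rho i] by [del], so the cover is admissible
    at scale [del]. *)
Lemma hausdorff_measure_eq0P t A : 0 < t ->
  hausdorff_measure d t A = 0%E <-> hausdorff_null t A.
Proof.
move=> t0; split=> [H0 eta eta0|nA].
  have c1 : (hausdorff_content d t 1 A < eta%:E)%E.
    apply: (@le_lt_trans _ _ 0%E); last by rewrite lte_fin.
    by rewrite -H0; apply: ereal_sup_ubound; exists 1 => //=.
  have [_ [U [AU dU1] <-] Ueta] := ereal_inf_lt c1.
  have dfin i : diam d (U i) = (fine (diam d (U i)))%:E.
    rewrite fineK// ge0_fin_numE ?diam_ge0//.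
    by rewrite (le_lt_trans (dU1 i))// ltry.
  exists U, (fun i => fine (diam d (U i))); split=> //.
  - by move=> i; rewrite fine_ge0 ?diam_ge0.
  - move=> i x y Ux Uy; rewrite -lee_fin -dfin.
    by apply: ereal_sup_ubound; left; exists x => //; exists y.
  - move=> n; rewrite -lee_fin; apply: le_trans (ltW Ueta).
    rewrite -sumEFin.
    under eq_bigr do rewrite -poweR_EFin -dfin.
    rewrite -(big_mkord xpredT (fun i => poweR (diam d (U i)) t)).
    by apply: nneseries_lim_ge => i _ _; exact: poweR_ge0.
apply/le_anti/andP; split; last first.
  apply: (@le_trans _ _ (hausdorff_content d t 1 A)).
    exact: hausdorff_content_ge0.
  by apply: ereal_sup_ubound; exists 1 => //=.
apply: ge_ereal_sup => _ [del /= del0 <-].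
apply/lee_addgt0Pr => e e0; rewrite add0e.
have eta0 : 0 < Num.min e (del `^ t) by rewrite lt_min e0 powR_gt0.
have [U [rho [AU rho0 Urho sum_rho]]] := nA _ eta0.
have diam_le i : (diam d (U i) <= (rho i)%:E)%E.
  apply: ge_ereal_sup => _ [[y /= hy [z /= hz <-]]|->]; rewrite lee_fin//.
  exact: Urho hy hz.
have pow_le i : (poweR (diam d (U i)) t <= (rho i `^ t)%:E)%E.
  rewrite -poweR_EFin; apply: gt0_ler_poweR => //; first exact: ltW.
    by rewrite in_itv /= diam_ge0 leey.
  by rewrite in_itv /= lee_fin rho0 leey.
apply: (@le_trans _ _ (\sum_(0 <= i <oo) (poweR (diam d (U i)) t))%E).
  apply: ereal_inf_lbound; exists U => //; split=> // i.
  apply: (le_trans (diam_le i)); rewrite lee_fin.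
  have : rho i `^ t <= del `^ t.
    have := sum_rho i.+1; rewrite big_ord_recr /= => h.
    have : 0 <= \sum_(j < i) rho j `^ t by apply: sumr_ge0 => j _; exact: powR_ge0.
    have : Num.min e (del `^ t) <= del `^ t by rewrite ge_min lexx orbT.
    by lra.
  apply: contraTT; rewrite -!ltNge => dr.
  by apply: gt0_ltr_powR => //; rewrite nnegrE// ltW.
apply: lime_le.
  by apply: is_cvg_nneseries => i _ _; exact: poweR_ge0.
near=> n.
apply: (@le_trans _ _ (\sum_(0 <= i < n) (rho i `^ t)%:E)%E).
  by apply: lee_sum => i _; exact: pow_le.
rewrite big_mkord sumEFin lee_fin; apply: (le_trans (sum_rho n)).
by rewrite ge_min lexx.
Unshelve. all: by end_near. Qed.

Lemma hausdorff_null_sub t A A' : A `<=` A' ->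
  hausdorff_null t A' -> hausdorff_null t A.
Proof.
move=> AA nA eta /nA[U [rho [AU h1 h2 h3]]].
by exists U, rho; split=> //; exact: subset_trans AU.
Qed.

Lemma hausdorff_null_set0 t : 0 < t -> hausdorff_null t set0.
Proof.
move=> t0 eta eta0; exists (fun=> set0), (fun=> 0); split=> // n.
by rewrite big1 ?(ltW eta0)// => i _; rewrite powR0// gt_eqF.
Qed.

(** The [n]-th set gets the budget [eta / 2^(n+1)], and the double family of covers is listed by a
    pairing code. Codes of no pair receive the empty set and 0, whose power vanishes since
    [t > 0]. *)
Lemma hausdorff_null_bigcup t (A : nat -> set Z) : 0 < t ->
  (forall n, hausdorff_null t (A n)) -> hausdorff_null t (\bigcup_n A n).
Proof.
move=> t0 nA eta eta0.
have eps0 n : 0 < eta * 2^-1 ^+ n.+1 by rewrite mulr_gt0// exprn_gt0.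
have /choice[U /choice[rho Urho]] := fun n => nA n _ (eps0 n).
pose V k := if @pickle_inv (nat * nat)%type k is Some ij then U ij.1 ij.2 else set0.
pose s k := if @pickle_inv (nat * nat)%type k is Some ij then rho ij.1 ij.2 else 0.
exists V, s; split.
- move=> z [n _ Az]; have [/(_ _ Az)[j _ Uz] _ _ _] := Urho n.
  by exists (pickle (n, j)) => //; rewrite /V pickleK_inv.
- rewrite /s => k; case: pickle_inv => // -[i j] /=.
  by have [_ + _ _] := Urho i; apply.
- rewrite /s /V => k x y; case: pickle_inv => // -[i j] /=.
  by have [_ _ + _] := Urho i; apply.
move=> n.
pose ix (k : 'I_n) := if @pickle_inv (nat * nat)%type k is Some ij
  then maxn ij.1 ij.2 else 0%N.
pose N := (\max_(k < n) ix k).+1.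
pose G i j := rho i j `^ t.
have G0 i j : 0 <= G i j by exact: powR_ge0.
(* The indicator of [pickle (i, j) = k] lets the sums be exchanged; a pair has only one code, so it
   is counted at most once. *)
have s_le (k : 'I_n) : s k `^ t <=
    \sum_(i < N) \sum_(j < N) (pickle (i : nat, j : nat) == k)%:R * G i j.
  have := leq_bigmax (F := ix) k; rewrite /s.
  case E : pickle_inv => [[i j]|] /=; last first.
    rewrite powR0 ?gt_eqF// => _.
    by apply: sumr_ge0 => i _; apply: sumr_ge0 => j _; rewrite mulr_ge0// ler0n.
  rewrite {1}/ix E /= geq_max => /andP[iN jN].
  have iN' : (i < N)%N by rewrite ltnS.
  have jN' : (j < N)%N by rewrite ltnS.
  rewrite (bigD1 (Ordinal iN'))//= (bigD1 (Ordinal jN'))//=.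
  have := @pickle_invK (nat * nat)%type k; rewrite E /= => ->.
  rewrite eqxx mul1r -/(G i j) -addrA lerDl addr_ge0//.
    by apply: sumr_ge0 => ? _; rewrite mulr_ge0// ler0n.
  by apply: sumr_ge0 => ? _; apply: sumr_ge0 => ? _; rewrite mulr_ge0// ler0n.
apply: (le_trans (ler_sum _ (fun k _ => s_le k))).
rewrite exchange_big /=.
apply: (@le_trans _ _ (\sum_(i < N) eta * 2^-1 ^+ i.+1)).
  apply: ler_sum => i _; rewrite exchange_big /=.
  have [_ _ _ /(_ N)] := Urho i; apply: le_trans.
  apply: ler_sum => j _; rewrite -mulr_suml ler_piMl//.
  case: (ltnP (pickle (i : nat, j : nat)) n) => [lt_n|ge_n].
    rewrite (bigD1 (Ordinal lt_n))//= eqxx big1 ?addr0// => k.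
    by rewrite -val_eqE /= eq_sym => /negbTE ->.
  by rewrite big1 // => k _; rewrite gtn_eqF// (leq_trans _ ge_n).
by rewrite -mulr_sumr ger_pMr// sum_half_le1.
Qed.

End HausdorffNull.
Arguments hausdorff_null {R Z} d t A.

(** * Volumes of balls and averages *)

Section MetricMeasure.
Context {R : realType} {dx : measure_display} {X : measurableType dx}.
Context {d : X -> X -> R} {mu : {measure set X -> \bar R}}.
Hypothesis mm : mm_space d mu.
Implicit Types (x y : X) (r s c : R) (u : X -> R).

Let md : is_metric d := mm.1.

Definition vol x r : R := fine (mu (oball d x r)).

Lemma measurable_mopen (U : set X) : mopen d U -> measurable U.
Proof.
move=> oU; have [_ [-> _]] := mm.
exact: sub_sigma_algebra.
Qed.

Lemma measurable_oball x r : measurable (oball d x r).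
Proof. exact/measurable_mopen/mopen_oball. Qed.

Lemma measurable_cball x r : measurable (cball d x r).
Proof.
rewrite -(setCK (cball d x r)); apply: measurableC.
exact/measurable_mopen/mopen_setC_cball.
Qed.

Lemma oball_center x r : 0 < r -> oball d x r x.
Proof. by rewrite /oball /= dist_refl. Qed.

Lemma mu_oballE x r : 0 < r -> mu (oball d x r) = (vol x r)%:E.
Proof.
move=> r0; have [_ [_ /(_ _ (mopen_oball md x r))]] := mm.
case=> [|h1 h2]; first by exists x; exact: oball_center.
by rewrite /vol fineK// ge0_fin_numE.
Qed.

Lemma vol_gt0 x r : 0 < r -> 0 < vol x r.
Proof.
move=> r0; have [_ [_ /(_ _ (mopen_oball md x r))]] := mm.
case=> [|h1 h2]; first by exists x; exact: oball_center.
by rewrite /vol fine_gt0// h1.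
Qed.

Lemma vol_le x y r s : 0 < r -> 0 < s -> d y x + r <= s -> vol x r <= vol y s.
Proof.
move=> r0 s0 h; rewrite -lee_fin -!mu_oballE//.
by apply: le_measure; rewrite ?inE; [exact: measurable_oball..|exact: sub_oball].
Qed.

Lemma mu_oball_lty x r : 0 < r -> (mu (oball d x r) < +oo)%E.
Proof. by move=> r0; rewrite mu_oballE// ltry. Qed.

Lemma mcontinuous_measurable u :
  mcontinuous d (fun a b => `|a - b|) u -> measurable_fun setT u.
Proof.
move=> cu _; apply: (measurability _ (RGenOInfty.measurableE R)) => //.
move=> _ [_ [a ->] <-]; rewrite setTI; apply: measurable_mopen => x /=.
rewrite in_itv /= andbT => ax.
have [|del del0 hdel] := cu x (u x - a); first by rewrite subr_gt0.
exists del => // y /hdel h /=; rewrite in_itv /= andbT.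
by have := ler_norm (u x - u y); lra.
Qed.

Definition homogeneous_on (Q : R) (K : set X) (C R0 : R) : Prop :=
  forall x r1 r2, K x -> 0 < r1 -> r1 <= r2 -> r2 < R0 ->
    vol x r2 <= C * (r2 / r1) `^ Q * vol x r1.

Lemma vol_homogeneous (Q : R) : loc_homogeneous d mu Q ->
  forall K, mcompact d K -> exists R0 C : R, [/\ 0 < R0, 1 <= C &
    homogeneous_on Q K C R0].
Proof.
move=> hom K /hom[R0 [C [R00 [C1 h]]]]; exists R0, C; split=> // x r1 r2 Kx r10 r12 r2R.
have r20 : 0 < r2 by exact: lt_le_trans r12.
have := h x r1 r2 Kx r10 r12 r2R.
rewrite !mu_oballE// -!EFinM lee_fin.
rewrite ler_pdivrMr ?powR_gt0// => /le_trans; apply.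
rewrite powRM ?invr_ge0 ?(ltW r10) ?(ltW r20)// -[r1^-1]powR_inv1 ?(ltW r10)//.
rewrite -powRrM mulN1r powRN.
by rewrite le_eqVlt; apply/orP; left; apply/eqP; ring.
Qed.

Lemma mopen_seq_lower_bound (s : seq (set X)) :
  (forall U, U \in s -> mopen d U /\ U !=set0) ->
  exists2 c : R, 0 < c & forall U, U \in s -> (c%:E <= mu U)%E.
Proof.
elim: s => [|U s IH] hs; first by exists 1.
have [|c c0 hc] := IH; first by move=> V Vs; apply: hs; rewrite in_cons Vs orbT.
have [oU U0] := hs U (mem_head _ _).
have [_ [_ /(_ U oU U0)[U_gt0 U_lty]]] := mm.
have Ufin : mu U = (fine (mu U))%:E by rewrite fineK// ge0_fin_numE.
exists (Num.min c (fine (mu U))); first by rewrite lt_min c0 fine_gt0// U_gt0.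
move=> V; rewrite in_cons => /orP[/eqP ->|Vs].
  by rewrite Ufin lee_fin /= ge_min lexx orbT.
by apply: (le_trans _ (hc V Vs)); rewrite lee_fin ge_min lexx.
Qed.

(** Finitely many balls of radius [r / 2] cover [K], and every ball [B(x, r)] with [x] in [K]
    contains one of them. *)
Lemma vol_compact_lower_bound K r : mcompact d K -> 0 < r ->
  exists2 c : R, 0 < c & forall x, K x -> c <= vol x r.
Proof.
move=> cK r0.
have r20 : 0 < r / 2 by rewrite divr_gt0.
have [||s [sF Ks]] := cK [set U | exists x, U = oball d x (r / 2)].
- by move=> _ [x ->]; exact: mopen_oball.
- move=> x Kx; exists (oball d x (r / 2)); first by exists x.
  exact: oball_center.
have [|c c0 hc] := mopen_seq_lower_bound s.
  move=> U /sF[x ->]; split; first exact: mopen_oball.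
  by exists x; exact: oball_center.
exists c => // x /Ks[U /= Us Ux].
have [z Uz] := sF _ Us; move: Ux; rewrite Uz /oball /= => zx.
rewrite -lee_fin; apply: (le_trans (hc _ Us)); rewrite Uz mu_oballE// lee_fin.
by apply: vol_le => //; rewrite (dist_sym md); lra.
Qed.

(** Homogeneity compares [r] with the fixed radius [R0 / 2], where volumes are bounded below on [K].
    This converts sums of [r^Q] into sums of volumes, which add up over disjoint balls. *)
Lemma vol_lower_mass (Q : R) : loc_homogeneous d mu Q ->
  forall K, mcompact d K -> exists R0 c : R, [/\ 0 < R0, 0 < c &
    forall x r, K x -> 0 < r -> r < R0 -> r `^ Q <= c * vol x r].
Proof.
move=> hom K cK; have [R0 [C [R00 C1 hC]]] := vol_homogeneous Q hom K cK.
have R20 : 0 < R0 / 2 by rewrite divr_gt0.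
have [c c0 hc] := vol_compact_lower_bound K (R0 / 2) cK R20.
have C0 : 0 < C by lra.
exists (R0 / 2), (C * (R0 / 2) `^ Q / c); split=> //.
  by rewrite divr_gt0 ?mulr_gt0 ?powR_gt0.
move=> x r Kx r0 rR.
have := le_trans (hc x Kx) (hC x r (R0 / 2) Kx r0 (ltW rR) ltac:(lra)).
rewrite powRM ?invr_ge0 ?(ltW r0) ?(ltW R20)// -[r^-1]powR_inv1 ?(ltW r0)//.
rewrite -powRrM mulN1r powRN => h.
rewrite -mulrA mulrCA -mulrA ler_pdivlMl//.
have rQ : 0 < r `^ Q by exact: powR_gt0.
move: h; rewrite -(ler_pM2r rQ) => /le_trans; apply.
by rewrite le_eqVlt; apply/orP; left; apply/eqP; field; rewrite gt_eqF.
Qed.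

Lemma bounded_integrable_oball u L x r : measurable_fun setT u ->
  (forall y, `|u y| <= L) -> 0 < r -> mu.-integrable (oball d x r) (EFin \o u).
Proof.
move=> mu_u uL r0; apply: measurable_bounded_integrable.
- exact: measurable_oball.
- exact: mu_oball_lty.
- exact: measurable_funTS.
- exists L; split; first exact: num_real.
  by move=> M LM y _; exact: le_trans (uL y) (ltW LM).
Qed.

Lemma bounded_integrable_dist u L c x r : measurable_fun setT u ->
  (forall y, `|u y| <= L) -> 0 < r ->
  mu.-integrable (oball d x r) (EFin \o (fun y => `|u y - c|)).
Proof.
move=> mu_u uL r0.
apply: (@bounded_integrable_oball _ (L + `|c|)) => //.
- apply: measurableT_comp => //; apply: measurable_funB => //.
- move=> y; rewrite normr_id; apply: (le_trans (ler_normB _ _)).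
  by rewrite lerD2r.
Qed.

(** Integrate [|u - c|] over the larger ball and compare volumes. With [c] the average over that
    ball, this bounds one telescoping step by a mean oscillation. *)
Lemma maverage_dist_le u L c x r y s (D : R) : measurable_fun setT u ->
  (forall z, `|u z| <= L) -> 0 < r -> 0 < s -> d y x + r <= s ->
  vol y s <= D * vol x r ->
  `|maverage mu (oball d x r) u - c| <=
    D * ((vol y s)^-1 * \int[mu]_(z in oball d y s) `|u z - c|).
Proof.
move=> mu_u uL r0 s0 sub volD.
have mB := measurable_oball x r; have mB' := measurable_oball y s.
have iu := bounded_integrable_oball u L x r mu_u uL r0.
have ic : mu.-integrable (oball d x r) (EFin \o (fun=> c)).
  apply: (@bounded_integrable_oball _ `|c|) => //.
have vx := vol_gt0 x r r0; have vy := vol_gt0 y s s0.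
have -> : maverage mu (oball d x r) u - c =
    (vol x r)^-1 * \int[mu]_(z in oball d x r) (u z - c).
  rewrite RintegralB// Rintegral_cst// mulrBr mulrCA mulVf ?mulr1//.
  by rewrite gt_eqF.
rewrite normrM gtr0_norm ?invr_gt0//.
have iB : mu.-integrable (oball d x r) (EFin \o (fun z => u z - c)).
  by have := integrableB mB iu ic; apply: eq_integrable.
have h1 := le_normr_Rintegral mB iB.
have h2 : \int[mu]_(z in oball d x r) `|u z - c| <=
    \int[mu]_(z in oball d y s) `|u z - c|.
  rewrite /Rintegral; apply: fine_le.
  - apply: integrable_fin_num => //; exact: bounded_integrable_dist uL r0.
  - apply: integrable_fin_num => //; exact: bounded_integrable_dist uL s0.
  - apply: ge0_subset_integral => //; last exact: sub_oball.
    by have /measurable_int := bounded_integrable_dist u L c y s mu_u uL s0.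
have h3 := le_trans h1 h2.
have I0 : 0 <= \int[mu]_(z in oball d y s) `|u z - c| by exact: Rintegral_ge0.
apply: (@le_trans _ _ ((vol x r)^-1 * \int[mu]_(z in oball d y s) `|u z - c|)).
  by rewrite ler_pM2l ?invr_gt0.
rewrite mulrA ler_wpM2r// -ler_pdivrMr ?invr_gt0// invrK mulrC.
by rewrite ler_pdivrMr.
Qed.

End MetricMeasure.
Arguments vol {R dx X} d mu x r.
Arguments homogeneous_on {R dx X} d mu Q K C R0.

(** * Mean oscillation controlled by the energy of an upper gradient *)

Section Oscillation.
Context {R : realType} {dx : measure_display} {X : measurableType dx}.
Context {d : X -> X -> R} {mu : {measure set X -> \bar R}}.
Hypothesis mm : mm_space d mu.
Implicit Types (x y z : X) (r s a c : R) (u : X -> R) (g : X -> \bar R).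

Let md : is_metric d := mm.1.

(** Not divided by the volume: density bounds take the form [energy <= a^p * vol], with no
    quotient. *)
Definition energy (p : R) g x r : \bar R :=
  (\int[mu]_(y in oball d x r) poweR (g y) p)%E.

Lemma measurable_fun_poweR g (p : R) (D : set X) : measurable_fun setT g ->
  measurable_fun D (fun y => poweR (g y) p).
Proof.
move=> mg; apply: measurable_funTS.
by apply: (@measurableT_comp _ _ _ _ _ _ (fun e : \bar R => poweR e p)) => //;
  exact: measurable_poweR.
Qed.

(* Replaces Hoelder's inequality when comparing L^Q and L^p averages. *)
Lemma poweR_le_split (Q p a : R) (e : \bar R) : 0 < a -> 0 < Q -> Q < p ->
  (0 <= e)%E ->
  (poweR e Q <= (a `^ Q)%:E + (a `^ (Q - p))%:E * poweR e p)%E.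
Proof.
move=> a0 Q0 Qp; have p0 : 0 < p by exact: lt_trans Qp.
case: e => [s| |//] s0; last first.
  rewrite !poweRyr ?gt_eqF// mulry gtr0_sg ?powR_gt0// mul1e.
  by rewrite addey.
rewrite !poweR_EFin -EFinM -EFinD lee_fin; move: s0; rewrite lee_fin => s0.
have [sa|sa] := leP s a.
  apply: (@le_trans _ _ (a `^ Q)); last by rewrite lerDl mulr_ge0 ?powR_ge0.
  by apply: ge0_ler_powR => //; rewrite ?nnegrE// ltW.
have sgt0 : 0 < s by exact: lt_trans sa.
apply: (@le_trans _ _ (a `^ (Q - p) * s `^ p)); last by rewrite lerDr powR_ge0.
have -> : s `^ Q = s `^ (Q - p) * s `^ p.
  by rewrite -powRD ?subrK// gt_eqF.
rewrite ler_wpM2r ?powR_ge0//.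
rewrite -(opprB p Q) !powRN lef_pV2 ?posrE ?powR_gt0//.
by apply: ge0_ler_powR; rewrite ?nnegrE ?subr_ge0 ?ltW.
Qed.

(** Integrate the pointwise splitting: each summand contributes at most [a^Q] times the volume, the
    second because [a^(Q - p) * a^p = a^Q]. *)
Lemma energy_split_le (Q p a : R) g x r : measurable_fun setT g ->
  (forall y, 0 <= g y)%E -> 0 < Q -> Q < p -> 0 < a -> 0 < r ->
  (energy p g x r <= (a `^ p * vol d mu x r)%:E)%E ->
  (energy Q g x r <= (2 * a `^ Q * vol d mu x r)%:E)%E.
Proof.
move=> mg g0 Q0 Qp a0 r0 hE; have mB := measurable_oball mm x r.
apply: (@le_trans _ _ (\int[mu]_(y in oball d x r)
    ((a `^ Q)%:E + (a `^ (Q - p))%:E * poweR (g y) p))%E).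
  apply: ge0_le_integral => //.
  - by move=> y _; exact: poweR_ge0.
  - exact: measurable_fun_poweR.
  - apply: emeasurable_funD => //; apply: measurable_funeM.
    exact: measurable_fun_poweR.
  - by move=> y _; exact: poweR_le_split.
rewrite ge0_integralD//; last 3 first.
  - by move=> y _; rewrite lee_fin powR_ge0.
  - by move=> y _; rewrite mule_ge0 ?poweR_ge0// lee_fin powR_ge0.
  - by apply: measurable_funeM; exact: measurable_fun_poweR.
rewrite ge0_integralZl//; last 3 first.
  - exact: measurable_fun_poweR.
  - by move=> y _; exact: poweR_ge0.
  - by rewrite lee_fin powR_ge0.
rewrite integral_cst// (mu_oballE mm)// -EFinM.
have h : ((a `^ (Q - p))%:E * energy p g x r <= (a `^ Q * vol d mu x r)%:E)%E.
  apply: (@le_trans _ _ ((a `^ (Q - p))%:E * (a `^ p * vol d mu x r)%:E)%E).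
    by rewrite lee_wpmul2l// lee_fin powR_ge0.
  by rewrite -EFinM lee_fin mulrA -powRD ?subrK// gt_eqF.
apply: (le_trans (leeD2l _ h)).
by rewrite -EFinD lee_fin; lra.
Qed.

Definition poincare_on (Q : R) (K : set X) (C sig R0 : R) : Prop :=
  forall u g, mcontinuous d (fun a b => `|a - b|) u ->
    upper_gradient d (fun a b => `|a - b|) u g ->
    forall x r, K x -> 0 < r -> r < R0 ->
      (((vol d mu x r)^-1)%:E *
        \int[mu]_(y in oball d x r) (`|u y - maverage mu (oball d x r) u|)%:E
       <= C%:E * diam d (oball d x r) *
         poweR (((vol d mu x (sig * r))^-1)%:E * energy Q g x (sig * r)) Q^-1)%E.

(** The factor 4 is 2 from [diam B <= 2 r] times the bound 2 for [2^(1/Q)], which uses [Q >= 1]. *)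
Lemma mean_oscillation_le (Q p C sig R0 a L : R) (K : set X) u g x r :
  poincare_on Q K C sig R0 -> 1 <= Q -> Q < p -> 0 <= C -> 0 < sig -> 0 < a ->
  mcontinuous d (fun a b => `|a - b|) u -> (forall y, `|u y| <= L) ->
  upper_gradient d (fun a b => `|a - b|) u g ->
  K x -> 0 < r -> r < R0 ->
  (energy p g x (sig * r) <= (a `^ p * vol d mu x (sig * r))%:E)%E ->
  (vol d mu x r)^-1 *
    \int[mu]_(y in oball d x r) `|u y - maverage mu (oball d x r) u|
  <= 4 * C * r * a.
Proof.
move=> PI Q1 Qp C0 sig0 a0 cu uL ug Kx r0 rR hE.
have Q0 : 0 < Q by lra.
have sr0 : 0 < sig * r by rewrite mulr_gt0.
have mu_u := mcontinuous_measurable mm u cu.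
have := PI u g cu ug x r Kx r0 rR.
set c := maverage _ _ _ => h.
rewrite -lee_fin; apply: le_trans.
  rewrite EFinM [X in (_ * X)%E]fineK; last first.
    apply: (integrable_fin_num (measurable_oball mm x r)).
    exact: (bounded_integrable_dist mm u L c x r mu_u uL r0).
  exact: h.
have [mg [g0 _]] := ug.
have E1 := energy_split_le Q p a g x (sig * r) mg g0 Q0 Qp a0 sr0 hE.
have vs := vol_gt0 mm x (sig * r) sr0.
have E0 : (0 <= energy Q g x (sig * r))%E.
  by apply: integral_ge0 => y _; exact: poweR_ge0.
have P1 : (poweR (((vol d mu x (sig * r))^-1)%:E * energy Q g x (sig * r)) Q^-1
    <= (2 * a)%:E)%E.
  apply: (@le_trans _ _ (poweR (2 * a `^ Q)%:E Q^-1)).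
    apply: gt0_ler_poweR; rewrite ?invr_ge0 ?(ltW Q0)//.
    - by rewrite in_itv /= leey andbT mule_ge0// lee_fin invr_ge0 ltW.
    - by rewrite in_itv /= leey andbT lee_fin mulr_ge0// powR_ge0.
    - rewrite -(@lee_pmul2l _ (vol d mu x (sig * r))%:E)// muleA -EFinM.
      by rewrite mulfV ?gt_eqF// mul1e -EFinM [X in X%:E]mulrC.
  rewrite poweR_EFin lee_fin powRM ?powR_ge0// -powRrM mulfV ?gt_eqF//.
  rewrite powRr1 ?(ltW a0)// ler_pM2r//.
  by apply: ler1_powR; rewrite ?invf_le1//; lra.
have D1 := diam_oball_le md x r (ltW r0).
apply: (@le_trans _ _ ((C%:E * (2 * r)%:E) * (2 * a)%:E)%E).
  apply: lee_pmul => //; rewrite ?poweR_ge0//.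
    by rewrite mule_ge0 ?lee_fin ?diam_ge0.
  by rewrite lee_wpmul2l// lee_fin.
by rewrite -!EFinM lee_fin; lra.
Qed.

(** Once the radius is below the modulus of continuity at [y], [|u - u y| < e] on the whole ball.
    One such index suffices for the telescoping, as [e] is arbitrary. *)
Lemma maverage_cvg u L y r e : mcontinuous d (fun a b => `|a - b|) u ->
  (forall z, `|u z| <= L) -> 0 < r -> 0 < e ->
  exists n, `|maverage mu (oball d y (r * 2^-1 ^+ n)) u - u y| <= e.
Proof.
move=> cu uL r0 e0; have mu_u := mcontinuous_measurable mm u cu.
have [del del0 hdel] := cu y e e0.
pose n := Num.bound (r / del).
have rn : r * 2^-1 ^+ n < del.
  rewrite exprVn ltr_pdivrMr ?exprn_gt0// mulrC -ltr_pdivrMr//.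
  apply: (@lt_le_trans _ _ n%:R).
    by apply: archi_boundP; rewrite divr_ge0// ltW.
  by rewrite -natrX ler_nat ltnW// ltn_expl.
exists n; have rn0 : 0 < r * 2^-1 ^+ n by rewrite mulr_gt0// exprn_gt0.
set s := r * _ in rn rn0 *.
have hs : d y y + s <= s by rewrite (dist_refl md) add0r.
have hv : vol d mu y s <= 1 * vol d mu y s by rewrite mul1r.
apply: (le_trans (maverage_dist_le mm u L (u y) y s y s 1 mu_u uL rn0 rn0 hs hv)).
have vs := vol_gt0 mm y s rn0.
rewrite mul1r ler_pdivrMl// -[leRHS]mulrC.
rewrite -(Rintegral_cst mu (measurable_oball mm y s)).
apply: (le_Rintegral (measurable_oball mm y s)).
- exact: (bounded_integrable_dist mm u L (u y) y s mu_u uL rn0).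
- apply: (bounded_integrable_oball mm (fun=> e) `|e|) => //.
- move=> z; rewrite /oball /= => yz; rewrite distrC; apply: ltW.
  by apply: hdel; exact: lt_trans rn.
Qed.

End Oscillation.
Arguments energy {R dx X} d mu p g x r.
Arguments poincare_on {R dx X} d mu Q K C sig R0.

(** * A Morrey estimate by telescoping averages *)

Section Morrey.
Context {R : realType} {dx : measure_display} {X : measurableType dx}.
Context {d : X -> X -> R} {mu : {measure set X -> \bar R}}.
Hypothesis mm : mm_space d mu.

Let md : is_metric d := mm.1.

Lemma geometric_sum_le (rho : R) n : 0 <= rho -> rho < 1 ->
  \sum_(k < n) rho ^+ k <= (1 - rho)^-1.
Proof.
move=> r0 r1; have h : 0 < 1 - rho by rewrite subr_gt0.
rewrite -[leRHS]mul1r ler_pdivlMr//.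
have -> : (\sum_(k < n) rho ^+ k) * (1 - rho) = 1 - rho ^+ n.
  elim: n => [|n IH]; first by rewrite big_ord0 mul0r expr0 subrr.
  by rewrite big_ord_recr /= mulrDl IH exprS; ring.
by rewrite gerBl exprn_ge0.
Qed.

Lemma gt1_ltr_powR (a x y : R) : 1 < a -> x < y -> a `^ x < a `^ y.
Proof.
move=> a1 xy; rewrite /powR gt_eqF ?(lt_trans _ a1)//.
by rewrite ltr_expR ltr_pM2r// ln_gt0.
Qed.

(** The first increment has its own bound because the chain of balls changes its centre there. *)
Lemma telescope_le (c : nat -> R) (A0 A rho : R) n : 0 <= rho -> rho < 1 ->
  0 <= A -> `|c 1%N - c 0%N| <= A0 ->
  (forall k, `|c k.+2 - c k.+1| <= A * rho ^+ k) ->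
  `|c n.+1 - c 0%N| <= A0 + A / (1 - rho).
Proof.
move=> r0 r1 A_ge0 h0 h.
apply: (@le_trans _ _ (A0 + A * \sum_(k < n) rho ^+ k)); last first.
  by rewrite lerD2l ler_wpM2l// geometric_sum_le.
elim: n => [|n IH]; first by rewrite big_ord0 mulr0 addr0.
rewrite big_ord_recr /= mulrDr addrA.
apply: le_trans (lerD IH (h n)).
apply: le_trans (ler_normD _ _).
by rewrite [X in _ <= `|X|](_ : _ = c n.+2 - c 0%N)//; ring.
Qed.

Lemma energy_lee (p : R) (g : X -> \bar R) x r y s : measurable_fun setT g ->
  d y x + r <= s -> (energy d mu p g x r <= energy d mu p g y s)%E.
Proof.
move=> mg h; apply: ge0_subset_integral.
- exact: (measurable_oball mm).
- exact: (measurable_oball mm).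
- exact: measurable_fun_poweR.
- by move=> z _; exact: poweR_ge0.
- exact: sub_oball.
Qed.

(** [D] bounds the volume ratio of concentric balls with radii in ratio at most 3. The first summand
    pays for moving the centre from [x] to [y]; the second is a geometric series of ratio
    [2^(Q/p) / 2], convergent because [Q < p]. *)
Definition morrey_const (Q p C Ch : R) : R :=
  let D := Ch * 3 `^ Q in
  8 * C * D + 4 * C * D * D / (1 - 2 `^ (Q / p) / 2).

Lemma morrey_const_ge0 (Q p C Ch : R) : 0 < Q -> Q < p -> 0 <= C -> 0 <= Ch ->
  0 <= morrey_const Q p C Ch.
Proof.
move=> Q0 Qp C0 Ch0; rewrite /morrey_const.
have D0 : 0 <= Ch * 3 `^ Q by rewrite mulr_ge0 ?powR_ge0.
rewrite addr_ge0 ?mulr_ge0// invr_ge0 subr_ge0 ler_pdivrMr// mul1r.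
apply: ler1_powR; first lra.
by rewrite ler_pdivrMr ?mul1r; lra.
Qed.

(* The averages of u over the balls B(x, 2r), B(y, r), B(y, r/2), ... converge to
   u y; homogeneity makes the energy density grow at most like 2^(kQ/p) along
   this chain, which loses against the factor 2^-k of the Poincare inequality. *)
Lemma morrey_estimate (Q p C sig Rp Ch Rh a L r : R) (K : set X)
  (u : X -> R) (g : X -> \bar R) x y :
  poincare_on d mu Q K C sig Rp -> homogeneous_on d mu Q K Ch Rh ->
  1 <= Q -> Q < p -> 0 <= C -> 1 <= sig -> 1 <= Ch -> 0 < a ->
  mcontinuous d (fun a b => `|a - b|) u -> (forall z, `|u z| <= L) ->
  upper_gradient d (fun a b => `|a - b|) u g ->
  K x -> K y -> d x y < r -> 0 < r -> 2 * r < Rp -> 3 * sig * r < Rh ->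
  (energy d mu p g x (2 * sig * r) <=
    (a `^ p * vol d mu x (2 * sig * r))%:E)%E ->
  `|u y - maverage mu (oball d x (2 * r)) u| <= morrey_const Q p C Ch * r * a.
Proof.
move=> PI hom Q1 Qp C0 sig1 Ch1 a0 cu uL ug Kx Ky xy r0 rRp rRh hE.
have [mg [g0 _]] := ug.
have mu_u := mcontinuous_measurable mm u cu.
have Q0 : 0 < Q by lra.
have p0 : 0 < p by lra.
have sig0 : 0 < sig by lra.
have sr : r <= sig * r by rewrite ler_peMl// ltW.
pose D := Ch * 3 `^ Q.
have D1 : 1 <= D.
  rewrite -[leLHS]mulr1 ler_pM// -[leLHS](powRr0 3) ler_powR//; first lra.
  exact: ltW.
pose b : R := 2 `^ (Q / p).
have b1 : 1 <= b by rewrite -[leLHS](powRr0 2) ler_powR ?divr_ge0//; lra.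
have b2 : b < 2.
  rewrite -[ltRHS](@powRr1 _ 2)// gt1_ltr_powR; [by []|lra|].
  by rewrite ltr_pdivrMr ?mul1r.
pose rk k : R := r * 2^-1 ^+ k.
have rk0 k : 0 < rk k by rewrite mulr_gt0// exprn_gt0.
have rkr k : rk k <= r by rewrite ger_pMr// exprn_ile1//; lra.
(* Index 0 is the ball [B(x, 2r)]; index [k + 1] is the ball of radius [r / 2^k] about [y]. *)
pose c k := if k is k'.+1 then maverage mu (oball d y (rk k')) u
            else maverage mu (oball d x (2 * r)) u.
have yx : d y x < r by rewrite (dist_sym md).
have srk k : sig * rk k <= sig * r by rewrite ler_pM2l.
(* Since [b^p = 2^Q], the power [ak k ^ p] absorbs both [a^p] and the volume ratio [D * 2^(k Q)];
   here [D <= D^p], as [D] and [p] are at least 1. *)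
pose ak k := a * D * b ^+ k.
have ak0 k : 0 < ak k by rewrite !mulr_gt0 ?exprn_gt0//; lra.
have Ek k : (energy d mu p g y (sig * rk k) <=
    (ak k `^ p * vol d mu y (sig * rk k))%:E)%E.
  apply: (@le_trans _ _ (energy d mu p g x (2 * sig * r))).
    by apply: energy_lee => //; have := srk k; lra.
  apply: (le_trans hE); rewrite lee_fin.
  have s1 : 0 < sig * rk k by rewrite mulr_gt0.
  have v1 : vol d mu x (2 * sig * r) <= vol d mu y (3 * sig * r).
    by apply: (vol_le mm); rewrite ?mulr_gt0//; lra.
  have v2 : vol d mu y (3 * sig * r) <=
      D * (2 ^+ k) `^ Q * vol d mu y (sig * rk k).
    have := hom y (sig * rk k) (3 * sig * r) Ky s1 _ rRh.
    have -> : 3 * sig * r / (sig * rk k) = 3 * 2 ^+ k.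
      by rewrite /rk exprVn; field; rewrite ?expf_neq0 ?gt_eqF.
    rewrite powRM ?exprn_ge0// mulrA -/D; apply.
    by have := srk k; lra.
  apply: (@le_trans _ _ (a `^ p * (D * (2 ^+ k) `^ Q * vol d mu y (sig * rk k)))).
    by rewrite ler_wpM2l ?powR_ge0//; exact: le_trans v2.
  rewrite mulrA ler_wpM2r ?(ltW (vol_gt0 mm _ _ s1))//.
  have D0 : 0 <= D by lra.
  have b0 : 0 <= b ^+ k by rewrite exprn_ge0//; lra.
  have -> : ak k `^ p = a `^ p * (D `^ p * (b ^+ k) `^ p).
    rewrite -(powRM p D0 b0) -(powRM p (ltW a0)); last by rewrite mulr_ge0.
    by rewrite mulrA.
  rewrite ler_wpM2l ?powR_ge0// ler_pM ?powR_ge0//.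
    by apply: le1r_powR => //; lra.
  rewrite -(@powR_mulrn _ b) ?(le_trans _ b1)// /b -!powRrM.
  rewrite -(@powR_mulrn _ 2)// -powRrM.
  rewrite le_eqVlt; apply/orP; left; apply/eqP; congr (_ `^ _).
  by field; rewrite gt_eqF.
(* The inclusions of [B(y, r)] in [B(x, 2r)] and of [B(x, 2r)] in [B(y, 3r)] give the volume ratio
   [D]. *)
have step0 : `|c 1%N - c 0%N| <= D * (4 * C * (2 * r) * a).
  have hr0 : rk 0%N = r by rewrite /rk expr0 mulr1.
  rewrite /c hr0.
  have r20 : 0 < 2 * r by rewrite mulr_gt0.
  have v : vol d mu x (2 * r) <= D * vol d mu y r.
    apply: (@le_trans _ _ (vol d mu y (3 * r))).
      by apply: (vol_le mm); rewrite ?mulr_gt0//; lra.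
    have := hom y r (3 * r) Ky r0 _ _; rewrite mulfK ?gt_eqF//; apply; lra.
  apply: le_trans.
    by apply: (maverage_dist_le mm u L _ y r x (2 * r) D mu_u uL r0 r20 _ v); lra.
  rewrite ler_wpM2l//; first lra.
  apply: (mean_oscillation_le mm Q p C sig Rp a L K u g) => //.
  by rewrite mulrCA mulrA.
have stepk k : `|c k.+2 - c k.+1| <= 4 * C * D * D * r * a * (b / 2) ^+ k.
  have rkS : rk k.+1 = rk k / 2 by rewrite /rk exprS; ring.
  have rkS0 := rk0 k.+1.
  rewrite /c.
  have v : vol d mu y (rk k) <= D * vol d mu y (rk k.+1).
    have := hom y (rk k.+1) (rk k) Ky rkS0 _ _.
    have -> : rk k / rk k.+1 = 2 by rewrite rkS; field; rewrite gt_eqF.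
    have h1 : rk k.+1 <= rk k by rewrite rkS; have := rk0 k; lra.
    have h2 : rk k < Rh by have := rkr k; lra.
    move=> /(_ h1 h2) /le_trans; apply.
    rewrite ler_wpM2r ?(ltW (vol_gt0 mm _ _ _))// ler_wpM2l//; first lra.
    by rewrite ge0_ler_powR ?nnegrE//; lra.
  apply: le_trans.
    apply: (maverage_dist_le mm u L _ y _ y (rk k) D mu_u uL rkS0 (rk0 k) _ v).
    by rewrite (dist_refl md) rkS; have := rk0 k; lra.
  apply: (@le_trans _ _ (D * (4 * C * rk k * ak k))).
    rewrite ler_wpM2l//; first lra.
    apply: (mean_oscillation_le mm Q p C sig Rp (ak k) L K u g) => //.
    by have := rkr k; lra.
  rewrite /rk /ak expr_div_n exprVn le_eqVlt; apply/orP; left; apply/eqP; ring.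
have tel n : `|c n.+1 - c 0%N| <= morrey_const Q p C Ch * r * a.
  have -> : morrey_const Q p C Ch * r * a =
      D * (4 * C * (2 * r) * a) + 4 * C * D * D * r * a / (1 - b / 2).
    by rewrite /morrey_const -/D -/b; ring.
  apply: telescope_le => //; first by apply: divr_ge0; lra.
    by lra.
  by rewrite !mulr_ge0//; lra.
apply/ler_addgt0Pr => e e0.
have [n hn] := maverage_cvg mm u L y r e cu uL r0 e0.
have := ler_normD (u y - c n.+1) (c n.+1 - c 0%N); rewrite addrA subrK => h.
apply: (le_trans h); rewrite addrC lerD//.
by rewrite distrC.
Qed.

End Morrey.

(** * Images of balls under the mapping *)

Section ImageOfBalls.
Context {R : realType} {dx : measure_display} {X : measurableType dx}.
Context {d : X -> X -> R} {mu : {measure set X -> \bar R}}.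
Context {Y : Type} {dY : Y -> Y -> R}.
Hypothesis mm : mm_space d mu.
Hypothesis mdY : is_metric dY.

Lemma min_lipschitz (l a b : R) : `|Num.min a l - Num.min b l| <= `|a - b|.
Proof.
have h1 := ler_norm (a - b); have h2 := ler_norm (b - a).
rewrite (distrC b a) in h2.
rewrite ler_norml; case: (leP a l) => al; case: (leP b l) => bl;
  by apply/andP; split; lra.
Qed.

Lemma dist_lipschitz (o a b : Y) : `|dY o a - dY o b| <= dY a b.
Proof.
rewrite ler_norml; have := dist_triangle mdY o a b.
have := dist_triangle mdY o b a; have := dist_sym mdY a b.
by move=> h1 h2 h3; apply/andP; split; lra.
Qed.

(** Apply the Morrey estimate to the distance from [f y] truncated at [l = dY (f y) (f z)]: this
    function is bounded, inherits the upper gradient [g], and takes the values 0 at [y] and [l] at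
    [z]. Comparing both values with the average gives the factor 2. *)
Lemma image_oball_le (Q p C sig Rp Ch Rh a r : R) (K : set X)
  (f : X -> Y) (g : X -> \bar R) x y z :
  poincare_on d mu Q K C sig Rp -> homogeneous_on d mu Q K Ch Rh ->
  1 <= Q -> Q < p -> 0 <= C -> 1 <= sig -> 1 <= Ch -> 0 < a ->
  mcontinuous d dY f -> upper_gradient d dY f g ->
  K x -> K y -> K z -> d x y < r -> d x z < r ->
  0 < r -> 2 * r < Rp -> 3 * sig * r < Rh ->
  (energy d mu p g x (2 * sig * r) <=
    (a `^ p * vol d mu x (2 * sig * r))%:E)%E ->
  dY (f y) (f z) <= 2 * morrey_const Q p C Ch * r * a.
Proof.
move=> PI hom Q1 Qp C0 sig1 Ch1 a0 cf [mg [g0 ug]] Kx Ky Kz xy xz r0 rRp rRh hE.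
pose l := dY (f y) (f z).
pose u w := Num.min (dY (f y) (f w)) l.
have u_lip w w' : `|u w - u w'| <= dY (f w) (f w').
  exact: le_trans (min_lipschitz _ _ _) (dist_lipschitz _ _ _).
have cu : mcontinuous d (fun a b => `|a - b|) u.
  move=> w e /(cf w)[del del0 h]; exists del => // w' /h.
  exact: le_lt_trans.
have uL w : `|u w| <= l.
  have l0 : 0 <= l by exact: dist_ge0.
  have w0 : 0 <= dY (f y) (f w) by exact: dist_ge0.
  by rewrite ger0_norm /u ?ge_min ?lexx ?orbT// le_min w0.
have uug : upper_gradient d (fun a b => `|a - b|) u g.
  split=> //; split=> // gam rgam F hF.
  by apply: le_trans (ug gam rgam F hF); rewrite lee_fin.
have hy := morrey_estimate mm Q p C sig Rp Ch Rh a l r K u g x y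
  PI hom Q1 Qp C0 sig1 Ch1 a0 cu uL uug Kx Ky xy r0 rRp rRh hE.
have hz := morrey_estimate mm Q p C sig Rp Ch Rh a l r K u g x z
  PI hom Q1 Qp C0 sig1 Ch1 a0 cu uL uug Kx Kz xz r0 rRp rRh hE.
have uy : u y = 0.
  by rewrite /u (dist_refl mdY) min_l//; exact: dist_ge0.
have uz : u z = l by rewrite /u minxx.
move: hy hz; set c := maverage _ _ _; rewrite uy uz -/l => hy hz.
have := ler_norm (l - c); have := ler_norm (- (0 - c)); rewrite normrN.
by lra.
Qed.

End ImageOfBalls.

(** * Sums over disjoint families *)

Section DisjointSums.
Context {R : realType} {dx : measure_display} {X : measurableType dx}.
Context {mu : {measure set X -> \bar R}}.

Lemma sum_integral_disjoint_le (I : choiceType) (s : seq I) (F : I -> set X)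
  (h : X -> \bar R) (T : set X) :
  (forall i, measurable (F i)) -> measurable T -> uniq s ->
  trivIset [set` s] F -> (forall i, i \in s -> F i `<=` T) ->
  measurable_fun setT h -> (forall x, 0 <= h x)%E ->
  (\sum_(i <- s) \int[mu]_(x in F i) h x <= \int[mu]_(x in T) h x)%E.
Proof.
move=> mF mT us tF FT mh h0.
rewrite -ge0_integral_bigsetU//; last exact: measurable_funTS.
apply: ge0_subset_integral => //.
- by apply: bigsetU_measurable => i _; exact: mF.
- exact: measurable_funTS.
- move=> x; rewrite -bigcup_seq => -[i /= si Fx].
  exact: FT Fx.
Qed.

Lemma sum_measure_disjoint_le (I : choiceType) (s : seq I) (F : I -> set X)
  (T : set X) :
  (forall i, measurable (F i)) -> measurable T -> uniq s ->
  trivIset [set` s] F -> (forall i, i \in s -> F i `<=` T) ->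
  (\sum_(i <- s) mu (F i) <= mu T)%E.
Proof.
move=> mF mT us tF FT.
have := @sum_integral_disjoint_le I s F (cst 1%E) T mF mT us tF FT.
rewrite integral_cst// mul1e.
under eq_bigr do rewrite integral_cst// mul1e.
by apply.
Qed.

Lemma measure_bigsetU_seq_le (I : Type) (s : seq I) (F : I -> set X) :
  (forall i, measurable (F i)) ->
  (mu (\big[setU/set0]_(i <- s) F i) <= \sum_(i <- s) mu (F i))%E.
Proof.
move=> mF; elim: s => [|i s IH]; first by rewrite !big_nil measure0.
rewrite !big_cons; apply: (@le_trans _ _ (mu (F i) + mu (\big[setU/set0]_(j <- s) F j))%E).
  by apply: measureU2 => //; apply: bigsetU_measurable => j _; exact: mF.
exact: leeD2l.
Qed.

End DisjointSums.

(** * Weak-type bound for balls of large energy density *)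

Section WeakType.
Context {R : realType} {dx : measure_display} {X : measurableType dx}.
Context {d : X -> X -> R} {mu : {measure set X -> \bar R}}.
Hypothesis mm : mm_space d mu.

Let md : is_metric d := mm.1.

(** A Vitali selection among the balls enlarged by [Lam] is disjoint, so its energies add up to at
    most [V], while its fivefold enlargements cover every original ball. Disjointness of the
    original balls bounds the sum of their volumes by the measure of that cover. *)
Lemma weak_type_le (p Lam D V lam M : R) (g : X -> \bar R) (T : set X)
  (s : seq nat) (x : nat -> X) (r : nat -> R) :
  measurable_fun setT g -> measurable T ->
  (\int[mu]_(z in T) poweR (g z) p <= V%:E)%E ->
  1 <= Lam -> 0 < lam -> 0 <= D -> uniq s ->
  (forall i, i \in s -> 0 < r i <= M) ->
  (forall i, i \in s -> oball d (x i) (Lam * r i) `<=` T) ->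
  (forall i, i \in s ->
    vol d mu (x i) (5 * (Lam * r i)) <= D * vol d mu (x i) (Lam * r i)) ->
  trivIset [set` s] (fun i => oball d (x i) (r i)) ->
  (forall i, i \in s -> ((lam * vol d mu (x i) (Lam * r i))%:E <=
    energy d mu p g (x i) (Lam * r i))%E) ->
  \sum_(i <- s) vol d mu (x i) (r i) <= D * V / lam.
Proof.
move=> mg mT TV Lam1 lam0 D0 us rM subT dbl tri dense.
have Lam0 : 0 < Lam by lra.
have M_ok i : i \in s -> 0 < Lam * r i <= Lam * M.
  by move=> /rM/andP[r0 rM']; rewrite mulr_gt0//= ler_pM2l.
have [J [Js Jtri Jcov]] := @vitali_cover R X d nat [set` s] x
  (fun i => Lam * r i) (Lam * M) md M_ok.
pose s' := [seq i <- s | `[< J i >]].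
have us' : uniq s' by exact: filter_uniq.
have s's i : i \in s' -> i \in s by rewrite mem_filter => /andP[].
have s'J i : i \in s' -> J i by rewrite mem_filter => /andP[/asboolP].
have mB y t : measurable (oball d y t) by exact: (measurable_oball mm).
have r0 i : i \in s -> 0 < r i by move=> /rM/andP[].
have volE : (\sum_(i <- s) vol d mu (x i) (r i))%:E =
    (\sum_(i <- s) mu (oball d (x i) (r i)))%E.
  rewrite -sumEFin !big_seq; apply: eq_bigr => i si.
  by rewrite (mu_oballE mm)// r0.
rewrite ler_pdivlMr// -lee_fin EFinM volE.
pose U := \big[setU/set0]_(j <- s') oball d (x j) (5 * (Lam * r j)).
have h1 : (\sum_(i <- s) mu (oball d (x i) (r i)) <= mu U)%E.
  apply: sum_measure_disjoint_le => //.
    by apply: bigsetU_measurable => j _; exact: mB.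
  move=> i si z iz; have [j Jj sub] := Jcov i si.
  rewrite /U -bigcup_seq; exists j => /=.
    by rewrite mem_filter (Js _ Jj) andbT; apply/asboolP.
  apply: sub; move: iz; rewrite /oball /= => /lt_le_trans; apply.
  by rewrite ler_peMl// ltW// r0.
have h2 : (mu U <= \sum_(j <- s') (D * vol d mu (x j) (Lam * r j))%:E)%E.
  apply: le_trans; first exact: measure_bigsetU_seq_le.
  rewrite !big_seq; apply: lee_sum => j /s's js.
  have rj := r0 j js.
  by rewrite (mu_oballE mm) ?mulr_gt0// lee_fin dbl.
have h3 : (\sum_(j <- s') (lam * vol d mu (x j) (Lam * r j))%:E <= V%:E)%E.
  apply: le_trans TV; apply: le_trans.
    rewrite big_seq; apply: lee_sum => j /s's js; exact: dense.
  rewrite -big_seq; apply: sum_integral_disjoint_le => //.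
  - by apply: sub_trivIset Jtri => j /= /s'J.
  - by move=> j /s's; exact: subT.
  - exact: measurable_fun_poweR.
  - by move=> z; exact: poweR_ge0.
move: h3; rewrite sumEFin lee_fin => h3.
apply: (@le_trans _ _ ((\sum_(j <- s') D * vol d mu (x j) (Lam * r j))%:E * lam%:E)%E).
  by rewrite lee_wpmul2r ?lee_fin ?(ltW lam0)// (le_trans h1)// -sumEFin.
rewrite -EFinM lee_fin -mulr_sumr -mulrA ler_wpM2l//.
by rewrite mulrC mulr_sumr.
Qed.

End WeakType.

(** * Interpolation, covers by balls, and sums over levels *)

Section CoveringLemmas.
Context {R : realType}.

(** A weighted geometric mean is at most the larger entry; the sum replaces the maximum because it
    can be summed over a family. *)
Lemma powR_interpolate (A B tau : R) : 0 <= A -> 0 <= B -> 0 < tau < 1 ->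
  A `^ (1 - tau) * B `^ tau <= A + B.
Proof.
move=> A0 B0 /andP[t0 t1].
have h (Z : R) : 0 <= Z -> Z `^ (1 - tau) * Z `^ tau = Z.
  by move=> Z0; rewrite -powRD ?subrK ?oner_eq0// powRr1.
case: (leP A B) => AB.
  apply: (@le_trans _ _ B); last by rewrite lerDr.
  rewrite -[leRHS](h B)// ler_wpM2r ?powR_ge0// ge0_ler_powR ?nnegrE//.
  by rewrite subr_ge0 ltW.
apply: (@le_trans _ _ A); last by rewrite lerDl.
rewrite -[leRHS](h A)// ler_wpM2l ?powR_ge0// ge0_ler_powR ?nnegrE//; exact: ltW.
Qed.

Lemma powRD_le (x y t : R) : 0 <= x -> 0 <= y -> 0 < t ->
  (x + y) `^ t <= 2 `^ t * (x `^ t + y `^ t).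
Proof.
move=> x0 y0 t0.
have h (z : R) : 0 <= z -> x + y <= 2 * z -> (x + y) `^ t <= 2 `^ t * z `^ t.
  move=> z0 hz; rewrite -powRM// ge0_ler_powR ?nnegrE//; rewrite ?mulr_ge0 ?addr_ge0//.
  exact: ltW.
rewrite mulrDr; case: (leP x y) => xy.
  by apply: (le_trans (h y y0 _)); [lra|rewrite lerDr mulr_ge0 ?powR_ge0].
by apply: (le_trans (h x x0 _)); [lra|rewrite lerDl mulr_ge0 ?powR_ge0].
Qed.

(** Centres are picked in [A], where later estimates are available. Each radius exceeds the diameter
    bound by some [eps i], so that it is positive and the open ball covers the part of [A] in
    [U i]. *)
Lemma hausdorff_null_oballs (Z : Type) (d : Z -> Z -> R) (t eta : R)
  (A : set Z) : is_metric d -> 0 < t -> hausdorff_null d t A -> 0 < eta ->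
  A !=set0 -> exists (x : nat -> Z) (r : nat -> R),
    [/\ forall i, A (x i), forall i, 0 < r i,
        A `<=` \bigcup_i oball d (x i) (r i) &
        forall n, \sum_(i < n) r i `^ t <= eta].
Proof.
move=> md t0 nA eta0 [a0 Aa0].
(* Half for the diameters and half for the [eps i], after the factor [2^t] lost in [powRD_le]. *)
pose eta1 := eta / (2 `^ t * 2).
have t2 : 0 < 2 `^ t :> R by exact: powR_gt0.
have eta10 : 0 < eta1 by rewrite divr_gt0// mulr_gt0.
have [U [rho [AU rho0 Urho sum_rho]]] := nA _ eta10.
have /choice[x hx] i : exists z, A z /\ ((U i `&` A) !=set0 -> U i z).
  have [[z [Uz Az]]|n0] := pselect ((U i `&` A) !=set0).
    by exists z; split.
  by exists a0; split.
pose eps i := (eta1 * 2^-1 ^+ i.+1) `^ t^-1.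
have e0 i : 0 < eta1 * 2^-1 ^+ i.+1 by rewrite mulr_gt0 ?exprn_gt0.
exists x, (fun i => rho i + eps i); split.
- by move=> i; have [] := hx i.
- by move=> i; rewrite ltr_wpDl// powR_gt0.
- move=> z Az; have [i _ Uz] := AU z Az; exists i => //; rewrite /oball /=.
  have Ux : U i (x i) by apply: (hx i).2; exists z.
  by apply: (le_lt_trans (Urho i _ _ Ux Uz)); rewrite ltrDl powR_gt0.
move=> n.
apply: (@le_trans _ _ (2 `^ t * (\sum_(i < n) rho i `^ t +
    \sum_(i < n) eta1 * 2^-1 ^+ i.+1))).
  rewrite -big_split mulr_sumr /=; apply: ler_sum => i _.
  apply: (le_trans (powRD_le _ _ t (rho0 i) (powR_ge0 _ _) t0)).
  by rewrite /eps -powRrM mulVf ?gt_eqF// powRr1// ltW.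
have h : \sum_(i < n) eta1 * 2^-1 ^+ i.+1 <= eta1.
  by rewrite -mulr_sumr ger_pMr// sum_half_le1.
apply: (@le_trans _ _ (2 `^ t * (eta1 + eta1))).
  by rewrite ler_pM2l// lerD.
rewrite /eta1 le_eqVlt; apply/orP; left; apply/eqP; field.
by rewrite gt_eqF.
Qed.

(** Grouped by level, the terms of level [k] contribute at most [rho^k]. *)
Lemma level_sum_le (I : eqType) (s : seq I) (l : I -> nat) (B : I -> R) (rho : R) :
  0 <= rho -> rho < 1 ->
  (forall k, \sum_(i <- s | l i == k) B i <= 1) ->
  \sum_(i <- s) rho ^+ l i * B i <= (1 - rho)^-1.
Proof.
move=> r0 r1 hB.
pose N := (\max_(i <- s) l i).+1.
have -> : \sum_(i <- s) rho ^+ l i * B i =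
    \sum_(i <- s) \sum_(k < N | l i == k) rho ^+ k * B i.
  rewrite !big_seq; apply: eq_bigr => i si.
  have lN : (l i < N)%N by rewrite ltnS; exact: (leq_bigmax_seq _ si).
  rewrite (bigD1 (Ordinal lN))//= big1 ?addr0// => k /andP[/eqP lk].
  by rewrite -val_eqE /= lk eqxx.
rewrite (exchange_big_dep xpredT)//=.
apply: le_trans (geometric_sum_le rho N r0 r1).
apply: ler_sum => k _; rewrite -mulr_sumr ler_piMr// ?exprn_ge0//.
Qed.

End CoveringLemmas.

(** * Images of null sets, from estimates at small scales *)

Section ImageNull.
Context {R : realType} {dx : measure_display} {X : measurableType dx}.
Context {d : X -> X -> R} {mu : {measure set X -> \bar R}}.
Context {Y : Type} {dY : Y -> Y -> R}.
Hypothesis mm : mm_space d mu.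

Let md : is_metric d := mm.1.

Context {Q p : R} {f : X -> Y} {g : X -> \bar R} {K T : set X}.
Context {del0 M Lam c D V : R}.
Hypothesis p1 : 1 <= p.
Hypotheses (mg : measurable_fun setT g) (mT : measurable T).
Hypotheses (del0_gt0 : 0 < del0) (M_ge0 : 0 <= M) (Lam1 : 1 <= Lam).
Hypotheses (c_gt0 : 0 < c) (D_ge0 : 0 <= D) (V_ge0 : 0 <= V).
Hypothesis image_le : forall x r a, K x -> 0 < r -> r < del0 -> 0 < a ->
  (energy d mu p g x (Lam * r) <= (a `^ p * vol d mu x (Lam * r))%:E)%E ->
  forall y z, d x y < r -> d x z < r -> dY (f y) (f z) <= M * r * a.
Hypothesis lower_mass : forall x r, K x -> 0 < r -> r < del0 ->
  r `^ Q <= c * vol d mu x r.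
Hypothesis doubling : forall x r, K x -> 0 < r -> r < del0 ->
  vol d mu x (5 * (Lam * r)) <= D * vol d mu x (Lam * r).
Hypothesis sub_T : forall x r, K x -> 0 < r -> r < del0 ->
  oball d x (Lam * r) `<=` T.
Hypothesis muT : (mu T <= V%:E)%E.
Hypothesis gT : (\int[mu]_(x in T) poweR (g x) p <= V%:E)%E.

(** [c * V] serves level 0 and [c * D * V * 2^p] the positive levels; the final 1 makes the bound
    positive, so that it can be divided by. *)
Definition level_bound : R := c * (D * 2 `^ p + 1) * V + 1.

Lemma level_bound_gt0 : 0 < level_bound.
Proof.
rewrite /level_bound ltr_wpDl// !mulr_ge0 ?(ltW c_gt0)//.
by rewrite addr_ge0 ?mulr_ge0 ?powR_ge0.
Qed.

(** The energy is at most [V], and for [l] above [V / vol] one has [(2^l)^p >= 2^l >= l], using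
    [p >= 1]. The boolean form suits the search for a least level. *)
Lemma exists_level x r : K x -> 0 < r -> r < del0 ->
  exists l, `[< (energy d mu p g x (Lam * r) <=
    ((2 ^+ l) `^ p * vol d mu x (Lam * r))%:E)%E >].
Proof.
move=> Kx r0 rd.
have Lam0 : 0 < Lam by rewrite (lt_le_trans _ Lam1).
have Lr0 : 0 < Lam * r by rewrite mulr_gt0.
have v0 := vol_gt0 mm x (Lam * r) Lr0.
pose l := Num.bound (V / vol d mu x (Lam * r)).
exists l; apply/asboolP; apply: (@le_trans _ _ V%:E).
  apply: le_trans gT; apply: ge0_subset_integral => //.
  - exact: (measurable_oball mm).
  - exact: measurable_fun_poweR.
  - by move=> z _; exact: poweR_ge0.
  - exact: sub_T.
rewrite lee_fin -ler_pdivrMr//.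
have h : V / vol d mu x (Lam * r) <= 2 ^+ l.
  apply: (@le_trans _ _ l%:R).
    by apply/ltW/archi_boundP; rewrite divr_ge0// ltW.
  by rewrite -natrX ler_nat ltnW// ltn_expl.
apply: (le_trans h); apply: le1r_powR => //.
by rewrite exprn_ege1//; lra.
Qed.

(* A ball of level k > 0 has energy density above 2^((k-1)p), so the weak-type
   bound applies. *)
Lemma level_set_le (s : seq nat) (x : nat -> X) (r : nat -> R) (k : nat) :
  uniq s -> (forall i, K (x i)) -> (forall i, 0 < r i) ->
  (forall i, 5 * r i < del0) ->
  trivIset [set` s] (fun i => oball d (x i) (r i)) ->
  (forall i l, i \in s -> k = l.+1 ->
    (((2 ^+ l) `^ p * vol d mu (x i) (Lam * (5 * r i)))%:E <=
      energy d mu p g (x i) (Lam * (5 * r i)))%E) ->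
  (2 ^+ k) `^ p * \sum_(i <- s) r i `^ Q <= level_bound.
Proof.
move=> us Kx r0 rd tri dense.
have rd' i : r i < del0 by have := rd i; have := r0 i; lra.
have r50 i : 0 < 5 * r i by rewrite mulr_gt0.
have LE i : 5 * Lam * r i = Lam * (5 * r i) by ring.
have low : \sum_(i <- s) r i `^ Q <= c * \sum_(i <- s) vol d mu (x i) (r i).
  by rewrite mulr_sumr; apply: ler_sum => i _; exact: lower_mass.
have cV : 0 <= c * V by rewrite mulr_ge0// ltW.
have p2 : 0 <= 2 `^ p :> R by exact: powR_ge0.
(* Level 0 carries no lower density bound; there the disjoint balls lie in [T], of measure at most
   [V]. *)
case: k dense => [_|l dense].
  rewrite expr0 powR1 mul1r (le_trans low)//.
  have h : \sum_(i <- s) vol d mu (x i) (r i) <= V.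
    rewrite -lee_fin -sumEFin.
    under eq_bigr do rewrite -(mu_oballE mm)//.
    apply: le_trans muT; apply: sum_measure_disjoint_le => //.
    - by move=> i; exact: (measurable_oball mm).
    - move=> i _; apply: subset_trans (sub_T (x i) (5 * r i) _ _ _) => //.
      apply: (sub_oball md); rewrite (dist_refl md) add0r.
      have : 1 * (5 * r i) <= Lam * (5 * r i) by rewrite ler_pM2r.
      by have := r0 i; lra.
  apply: (@le_trans _ _ (c * V)); first by rewrite ler_pM2l.
  rewrite /level_bound.
  have : 0 <= c * V * (D * 2 `^ p) by rewrite !mulr_ge0// ltW.
  by lra.
have lam0 : 0 < (2 ^+ l) `^ p :> R by rewrite powR_gt0// exprn_gt0.
have h : \sum_(i <- s) vol d mu (x i) (r i) <= D * V / (2 ^+ l) `^ p.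
  apply: (weak_type_le mm p (5 * Lam) D V _ del0 g T s x r) => //.
  - by have := Lam1; lra.
  - by move=> i _; rewrite r0/= ltW.
  - by move=> i _; rewrite LE; exact: sub_T.
  - by move=> i _; rewrite LE; exact: doubling.
  - by move=> i si; rewrite LE; exact: dense.
rewrite exprS powRM ?exprn_ge0//.
apply: (@le_trans _ _ (2 `^ p * (2 ^+ l) `^ p * (c * (D * V / (2 ^+ l) `^ p)))).
  rewrite ler_wpM2l ?mulr_ge0 ?powR_ge0//; apply: (le_trans low).
  by rewrite ler_pM2l.
have -> : 2 `^ p * (2 ^+ l) `^ p * (c * (D * V / (2 ^+ l) `^ p)) =
    c * V * (D * 2 `^ p) by field; rewrite gt_eqF.
by rewrite /level_bound; lra.
Qed.

(* With e = 2^l and W bounding e^p r^Q summed over a level, the sum of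
   (r e)^alpha over that level is at most eta^(1-tau) W^tau times a factor that
   decays geometrically in l. *)
Lemma term_le (t tau alpha eta W r : R) (l : nat) :
  0 < tau < 1 -> (1 - tau) * t + tau * Q <= alpha -> alpha < p * tau ->
  0 < eta -> 0 < W -> 0 < r <= 1 ->
  (r * 2 ^+ l) `^ alpha <= eta `^ (1 - tau) * W `^ tau *
    (r `^ t / eta + (2 `^ (alpha - p * tau)) ^+ l *
      ((2 ^+ l) `^ p * r `^ Q / W)).
Proof.
move=> ht hal1 hal2 eta0 W0 /andP[r0 r1].
have e0 : 0 < 2 ^+ l :> R by rewrite exprn_gt0.
set e : R := 2 ^+ l in e0 *.
have rhoE : (2 `^ (alpha - p * tau)) ^+ l = e `^ (alpha - p * tau).
  by rewrite /e -powR_mulrn ?powR_ge0// -powRrM mulrC powRrM powR_mulrn.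
have rho1 : e `^ (alpha - p * tau) <= 1.
  rewrite -[leRHS](powRr0 e) ler_powR//; last by lra.
  by rewrite /e exprn_ege1//; lra.
rewrite rhoE powRM ?(ltW r0) ?(ltW e0)//.
(* Since [r <= 1], lowering the exponent of [r] can only increase the power. *)
apply: (@le_trans _ _ (r `^ ((1 - tau) * t + tau * Q) * e `^ alpha)).
  by rewrite ler_wpM2r ?powR_ge0// ger_powR// r0.
pose A := r `^ t / eta; pose B := e `^ p * r `^ Q / W.
have A0 : 0 <= A by rewrite divr_ge0 ?powR_ge0// ltW.
have B0 : 0 <= B by rewrite divr_ge0 ?mulr_ge0 ?powR_ge0// ltW.
have hE : r `^ ((1 - tau) * t + tau * Q) * e `^ alpha =
    eta `^ (1 - tau) * W `^ tau * e `^ (alpha - p * tau) *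
    (A `^ (1 - tau) * B `^ tau).
  have rt : r `^ ((1 - tau) * t) = eta `^ (1 - tau) * A `^ (1 - tau).
    rewrite -powRM ?(ltW eta0)// mulrC powRrM /A; congr (_ `^ _).
    by field; rewrite gt_eqF.
  have rQ : r `^ (tau * Q) = W `^ tau * B `^ tau * e `^ (- (p * tau)).
    rewrite -powRM ?(ltW W0)// -mulNr [e `^ (_ * _)]powRrM.
    rewrite -powRM ?powR_ge0//; last first.
      by rewrite mulr_ge0// ltW.
    rewrite mulrC powRrM; congr (_ `^ _); rewrite /B powRN.
    by field; rewrite ?gt_eqF ?powR_gt0.
  rewrite [r `^ (_ + _)]powRD ?(gt_eqF r0) ?implybT// rt rQ.
  by rewrite [e `^ (_ + _)]powRD ?(gt_eqF e0) ?implybT//; ring.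
rewrite hE -[leLHS]mulrA ler_wpM2l ?mulr_ge0 ?powR_ge0//.
apply: (@le_trans _ _ (e `^ (alpha - p * tau) * (A + B))).
  by rewrite ler_wpM2l ?powR_ge0//; exact: powR_interpolate.
(* The factor [e^(alpha - p tau)], at most 1, is dropped before [A] and kept before [B], where it
   gives the decay in the level. *)
rewrite mulrDr lerD2r ler_piMl//.
Qed.

(** The images of the selected balls, enlarged five times, cover [f(E)], with diameters bounded by
    [M * 5 r_i * 2^(l_i)]. Summing [term_le] leaves one part controlled by [eta0] and one by the
    level bounds. *)
Lemma image_null (t tau alpha : R) (E : set X) : E `<=` K -> 0 < t -> 0 < alpha ->
  0 < tau < 1 -> (1 - tau) * t + tau * Q <= alpha -> alpha < p * tau ->
  hausdorff_null d t E -> hausdorff_null dY alpha (f @` E).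
Proof.
move=> EK t0 al0 ht hal1 hal2 nE eta eta_gt0.
have [E0|E0] := pselect (E !=set0); last first.
  suff: hausdorff_null dY alpha (f @` E) by apply.
  apply: (@hausdorff_null_sub _ _ _ _ _ set0); last exact: hausdorff_null_set0.
  by move=> w [z Ez _]; apply: E0; exists z.
pose W := level_bound; have W0 : 0 < W := level_bound_gt0.
pose rho : R := 2 `^ (alpha - p * tau).
have rho_ge0 : 0 <= rho by exact: powR_ge0.
have rho1 : rho < 1.
  by rewrite -[ltRHS](powRr0 2) gt1_ltr_powR//; lra.
(* The 5 is the Vitali enlargement; adding 1 keeps the constant positive when [M = 0]. *)
pose M5 := 5 * M + 1.
have M5_gt0 : 0 < M5 by have := M_ge0; rewrite /M5; lra.
have irho : 0 <= (1 - rho)^-1 by rewrite invr_ge0; lra.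
pose A := M5 `^ alpha * (W `^ tau * (1 + (1 - rho)^-1)).
have A0 : 0 < A.
  by rewrite !mulr_gt0 ?powR_gt0// ltr_wpDr.
(* The entry 1 gives [r i <= 1] for [term_le]; [del0 / 10] keeps the fivefold radii below [del0]. *)
pose del := Num.min 1 (del0 / 10).
have del_gt0 : 0 < del by rewrite lt_min ltr01 divr_gt0.
(* The first entry forces every radius to be at most [del]; the second makes the final bound
   [A * eta0^(1 - tau)] at most [eta]. *)
pose eta0 := Num.min (del `^ t) ((eta / A) `^ (1 - tau)^-1).
have eta00 : 0 < eta0 by rewrite lt_min !powR_gt0// divr_gt0.
have [x [r [Ex r0 Ecov sum_r]]] :=
  @hausdorff_null_oballs R X d t eta0 E md t0 nE eta00 E0.
have r_del i : r i <= del.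
  have : r i `^ t <= del `^ t.
    have := sum_r i.+1; rewrite big_ord_recr /= => h.
    have : 0 <= \sum_(j < i) r j `^ t by apply: sumr_ge0 => j _; exact: powR_ge0.
    have : eta0 <= del `^ t by rewrite ge_min lexx.
    by lra.
  apply: contraTT; rewrite -!ltNge => dr.
  by apply: gt0_ltr_powR => //; rewrite nnegrE ltW.
have r1 i : r i <= 1 by apply: (le_trans (r_del i)); rewrite ge_min lexx.
have rd i : 5 * r i < del0.
  have : r i <= del0 / 10 by apply: (le_trans (r_del i)); rewrite ge_min lexx orbT.
  by have := del0_gt0; lra.
have r50 i : 0 < 5 * r i by rewrite mulr_gt0.
have Kx i : K (x i) by exact: EK.
have [|J [_ Jtri Jcov]] := @vitali_cover R X d nat setT x r 1 md.
  by move=> i _; rewrite r0 r1.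
(* [l i] is the least level of the fivefold ball, so its predecessor, if any, violates the density
   bound. *)
have /choice[l hl] i : exists l : nat,
    (energy d mu p g (x i) (Lam * (5 * r i)) <=
      ((2 ^+ l) `^ p * vol d mu (x i) (Lam * (5 * r i)))%:E)%E /\
    forall k, l = k.+1 ->
      (((2 ^+ k) `^ p * vol d mu (x i) (Lam * (5 * r i)))%:E <=
      energy d mu p g (x i) (Lam * (5 * r i)))%E.
  have [m /asboolP hm mmin] :=
    ex_minnP (exists_level (x i) (5 * r i) (Kx i) (r50 i) (rd i)).
  exists m; split=> // k mk; apply: ltW; rewrite ltNge.
  by apply/negP => h; have /mmin := asboolT h; rewrite mk ltnn.
have l_le i := (hl i).1.
have l_gt i := (hl i).2.
pose U i := if `[< J i >] then f @` oball d (x i) (5 * r i) else set0.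
pose s i := if `[< J i >] then M * (5 * r i) * 2 ^+ l i else 0.
have s_ge0 i : 0 <= s i.
  by rewrite /s; case: ifP => // _; rewrite !mulr_ge0 ?exprn_ge0// ltW.
exists U, s; split=> //.
- move=> _ [z Ez <-]; have [i _ Bz] := Ecov z Ez.
  have [j Jj sub] := Jcov i I; exists j => //.
  by rewrite /U asboolT//; exists z => //; exact: sub.
- rewrite /U /s => i; case: ifP => // _ _ _ [y By <-] [z Bz <-].
  by apply: (image_le (x i) (5 * r i) (2 ^+ l i)) => //; rewrite exprn_gt0.
move=> n; pose sq := [seq i <- index_iota 0 n | `[< J i >]].
have usq : uniq sq by rewrite filter_uniq// iota_uniq.
have sqJ i : i \in sq -> J i by rewrite mem_filter => /andP[/asboolP].
have e1 : \sum_(i < n) s i `^ alpha <=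
    M5 `^ alpha * \sum_(i <- sq) (r i * 2 ^+ l i) `^ alpha.
  rewrite mulr_sumr big_filter [leRHS]big_mkcond /=.
  rewrite -(big_mkord xpredT (fun i => s i `^ alpha)).
  apply: ler_sum => i _; rewrite /s; case: ifP => _; last first.
    by rewrite powR0// gt_eqF.
  have e0 : 0 <= r i * 2 ^+ l i by rewrite mulr_ge0 ?exprn_ge0// ltW.
  rewrite -powRM// ?(ltW M5_gt0)//; apply: ge0_ler_powR; rewrite ?nnegrE ?(ltW al0)//.
  - by rewrite !mulr_ge0 ?exprn_ge0// ltW.
  - by rewrite mulr_ge0// ltW.
  - rewrite (_ : M * _ * _ = 5 * M * (r i * 2 ^+ l i)); last by ring.
    by rewrite ler_wpM2r// /M5 lerDl.
have e2 : \sum_(i <- sq) r i `^ t / eta0 <= 1.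
  rewrite -mulr_suml ler_pdivrMr// mul1r; apply: le_trans (sum_r n).
  rewrite big_filter [leLHS]big_mkcond /= -(big_mkord xpredT (fun i => r i `^ t)).
  by apply: ler_sum => i _; case: ifP => // _; exact: powR_ge0.
(* Dividing by the bound [W] from [level_set_le] makes every level sum at most 1. *)
have e3 : \sum_(i <- sq) rho ^+ l i * ((2 ^+ l i) `^ p * r i `^ Q / W)
    <= (1 - rho)^-1.
  apply: level_sum_le => // k.
  rewrite -mulr_suml ler_pdivrMr// mul1r.
  have := level_set_le [seq i <- sq | l i == k] x r k.
  rewrite filter_uniq// mulr_sumr big_filter => h.
  rewrite (eq_bigr (fun i => (2 ^+ k) `^ p * r i `^ Q)) => [|i /eqP ->//].
  apply: h => //.
    apply: sub_trivIset Jtri => i /=.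
    by rewrite mem_filter => /andP[_ /sqJ].
  move=> i m; rewrite mem_filter => /andP[/eqP lk _] km.
  by apply: l_gt; rewrite lk.
have e4 : \sum_(i <- sq) (r i * 2 ^+ l i) `^ alpha <=
    eta0 `^ (1 - tau) * W `^ tau * (1 + (1 - rho)^-1).
  apply: (@le_trans _ _ (\sum_(i <- sq) eta0 `^ (1 - tau) * W `^ tau *
    (r i `^ t / eta0 + rho ^+ l i * ((2 ^+ l i) `^ p * r i `^ Q / W)))).
    by apply: ler_sum => i _; apply: term_le => //; rewrite r0 r1.
  rewrite -mulr_sumr ler_wpM2l ?mulr_ge0 ?powR_ge0//.
  by rewrite big_split /=; exact: lerD.
have e5 : eta0 `^ (1 - tau) <= eta / A.
  have /andP[_ tau1] := ht.
  have ht1 : 0 < 1 - tau by rewrite subr_gt0.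
  have eA : 0 <= eta / A by rewrite divr_ge0 ?ltW.
  apply: (@le_trans _ _ (((eta / A) `^ (1 - tau)^-1) `^ (1 - tau))).
    apply: ge0_ler_powR; rewrite ?nnegrE ?powR_ge0 ?(ltW ht1) ?(ltW eta00)//.
    by rewrite ge_min lexx orbT.
  by rewrite -powRrM mulVf ?gt_eqF// powRr1.
apply: (le_trans e1).
apply: (@le_trans _ _ (M5 `^ alpha *
    (eta / A * W `^ tau * (1 + (1 - rho)^-1)))).
  rewrite ler_wpM2l ?powR_ge0//; apply: (le_trans e4).
  by rewrite -[leLHS]mulrA -[leRHS]mulrA ler_wpM2r// mulr_ge0 ?powR_ge0// addr_ge0.
rewrite [leLHS](_ : _ = eta / A * A); last by rewrite /A; ring.
by rewrite divfK// gt_eqF.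
Qed.

End ImageNull.

(** * Localisation to compact sets *)

Section Global.
Context {R : realType} {dx : measure_display} {X : measurableType dx}.
Context {d : X -> X -> R} {mu : {measure set X -> \bar R}}.
Hypothesis mm : mm_space d mu.

Let md : is_metric d := mm.1.

(** The whole space is itself open, so [mm_space] applies to it. *)
Lemma mu_setT_lty : [set: X] !=set0 -> (mu setT < +oo)%E.
Proof. by case: mm => _ [_ h] /h[]// x _; exists 1. Qed.

(** For [N] disjoint [r]-balls centred in [K], [N r^Q <= c m], so the powers [(10 r)^(Q+1)] sum to
    at most a constant times [r]. This makes [hdim d E] finite. *)
Lemma compact_hausdorff_null (Q : R) (K : set X) : 0 < Q ->
  loc_homogeneous d mu Q -> mcompact d K -> hausdorff_null d (Q + 1) K.
Proof.
move=> Q0 hom cK eta eta0.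
have Q10 : 0 < Q + 1 by rewrite addr_gt0.
have [[x0 Kx0]|K0] := pselect (K !=set0); last first.
  suff: hausdorff_null d (Q + 1) K by apply.
  apply: (@hausdorff_null_sub _ _ _ _ _ set0); last exact: hausdorff_null_set0.
  by move=> z Kz; apply: K0; exists z.
have [R0 [c [R00 c0 low]]] := vol_lower_mass mm Q hom K cK.
have muTfin : mu setT = (fine (mu setT))%:E.
  by rewrite fineK// ge0_fin_numE// mu_setT_lty//; exists x0.
pose m := fine (mu setT) + 1.
have m0 : 0 < m by rewrite ltr_wpDl// fine_ge0.
pose A := 10 `^ (Q + 1) * (c * m).
have A0 : 0 < A by rewrite !mulr_gt0 ?powR_gt0.
pose r := Num.min (R0 / 2) (eta / A).
have r0 : 0 < r by rewrite lt_min !divr_gt0.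
have rR : r < R0.
  have : r <= R0 / 2 by rewrite ge_min lexx.
  by lra.
have r50 : 0 < 5 * r by rewrite mulr_gt0.
have [||s [sF Ks]] := cK [set U | exists2 x, K x & U = oball d x r].
- by move=> _ [x _ ->]; exact: mopen_oball.
- move=> x Kx; exists (oball d x r); first by exists x.
  exact: (oball_center mm).
have /choice[x hx] i : exists z, (i < size s)%N ->
    K z /\ nth set0 s i = oball d z r.
  case: (ltnP i (size s)) => [lt_i|]; last by exists x0.
  by have [z Kz ->] := sF _ (mem_nth set0 lt_i); exists z.
have [|J [JD Jtri Jcov]] := @vitali_cover R X d nat
    [set i | (i < size s)%N] x (fun=> r) r md.
  by move=> i _; rewrite r0 lexx.
exists (fun i => if `[< J i >] then oball d (x i) (5 * r) else set0).
exists (fun i => if `[< J i >] then 10 * r else 0); split.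
- move=> z /Ks[U /= Us Uz].
  have iU : (index U s < size s)%N by rewrite index_mem.
  have [_ hU] := hx _ iU; rewrite nth_index// in hU.
  have [j Jj sub] := Jcov _ iU; exists j => //.
  by rewrite asboolT//; apply: sub; rewrite -hU.
- by move=> i; case: ifP => // _; rewrite mulr_ge0// ltW.
- move=> i y z; case: ifP => // _; rewrite /oball /= => hy hz.
  by have := dist_triangle md y (x i) z; have := dist_sym md y (x i); lra.
move=> n; pose sq := [seq i <- index_iota 0 n | `[< J i >]].
have usq : uniq sq by rewrite filter_uniq// iota_uniq.
have sqJ i : i \in sq -> J i by rewrite mem_filter => /andP[/asboolP].
have -> : \sum_(i < n) (if `[< J i >] then 10 * r else 0) `^ (Q + 1) =
    10 `^ (Q + 1) * r * \sum_(i <- sq) r `^ Q.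
  rewrite -(big_mkord xpredT
    (fun i => (if `[< J i >] then 10 * r else 0) `^ (Q + 1))).
  rewrite mulr_sumr big_filter [RHS]big_mkcond /=.
  apply: eq_bigr => i _; case: ifP => _; last by rewrite powR0// gt_eqF.
  rewrite powRM ?(ltW r0)// -mulrA; congr (_ * _).
  by rewrite powRD ?(gt_eqF r0) ?implybT// powRr1 ?(ltW r0)// mulrC.
have vol_sum : \sum_(i <- sq) vol d mu (x i) r <= m.
  apply: (@le_trans _ _ (fine (mu setT))); last by rewrite lerDl.
  rewrite -lee_fin -sumEFin -muTfin.
  under eq_bigr do rewrite -(mu_oballE mm)//.
  apply: sum_measure_disjoint_le => //.
  - by move=> i; exact: (measurable_oball mm).
  - by apply: sub_trivIset Jtri => i /= /sqJ.
have h : \sum_(i <- sq) r `^ Q <= c * m.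
  apply: (@le_trans _ _ (c * \sum_(i <- sq) vol d mu (x i) r)); last by rewrite ler_pM2l.
  rewrite mulr_sumr !big_seq; apply: ler_sum => i /sqJ Ji.
  by apply: low => //; have [] := hx i (JD _ Ji).
apply: (@le_trans _ _ (10 `^ (Q + 1) * r * (c * m))).
  by rewrite ler_wpM2l// mulr_ge0 ?powR_ge0// ltW.
have -> : 10 `^ (Q + 1) * r * (c * m) = r * A by rewrite /A; ring.
by rewrite -ler_pdivlMr// ge_min lexx orbT.
Qed.

(** Exhaust [X] by closed balls of integer radius. The map is arbitrary, so the identity localises
    [E] itself. *)
Lemma hausdorff_null_local {Z : Type} {e : Z -> Z -> R} (t : R) (f : X -> Z)
  (E : set X) : 0 < t ->
  (forall x (n : nat), hausdorff_null e t (f @` (E `&` cball d x n%:R))) ->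
  hausdorff_null e t (f @` E).
Proof.
move=> t0 h; have [[x0 Ex0]|E0] := pselect (E !=set0); last first.
  apply: (@hausdorff_null_sub _ _ _ _ _ set0); last exact: hausdorff_null_set0.
  by move=> w [z Ez _]; apply: E0; exists z.
apply: (@hausdorff_null_sub _ _ _ _ _ _ _ (hausdorff_null_bigcup t _ t0 (h x0))).
move=> _ [z Ez <-]; exists (Num.bound (d x0 z)) => //; exists z => //; split=> //.
by rewrite /cball /= ltW// archi_boundP// dist_ge0.
Qed.

Context {Y : Type} {dY : Y -> Y -> R}.
Hypothesis mdY : is_metric dY.

(** Restrict to the part of [E] in a closed ball of radius [n]. All constants come from the
    concentric compact ball of radius [n + 1], which contains the enlarged balls [B(x, 2 sig r)]. *)
Lemma sobolev_image_null (Q p t tau alpha : R) (f : X -> Y) (g : X -> \bar R)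
  (E : set X) : 1 <= Q -> Q < p -> mproper d ->
  loc_homogeneous d mu Q -> loc_poincare d mu Q -> mcontinuous d dY f ->
  upper_gradient d dY f g -> Lp_loc d mu p g ->
  0 < t -> 0 < alpha -> 0 < tau < 1 ->
  (1 - tau) * t + tau * Q <= alpha -> alpha < p * tau ->
  hausdorff_null d t E -> hausdorff_null dY alpha (f @` E).
Proof.
move=> Q1 Qp prop hom PI cf ug [mg gLp] t0 al0 ht hal1 hal2 nE.
apply: hausdorff_null_local => // x0 n.
pose K1 := cball d x0 (n%:R + 1).
have cK1 : mcompact d K1 by exact: prop.
have [C [sig [Rp [C1 [sig1 [Rp0 PIK]]]]]] := PI K1 cK1.
have {}PIK : poincare_on d mu Q K1 C sig Rp by exact: PIK.
have [Rh [Ch [Rh0 Ch1 homK]]] := vol_homogeneous mm Q hom K1 cK1.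
have [R1 [c [R10 c0 low]]] := vol_lower_mass mm Q hom K1 cK1.
have Q0 : 0 < Q by lra.
have sig0 : 0 < sig by lra.
(* The entries serve, in order, the Poincare inequality on [B(x, 2r)], the lower mass bound,
   homogeneity up to radius [5 * (2 sig r)], and the inclusion of [B(x, 2 sig r)] in [K1]. *)
pose del0 := Num.min (Num.min (Rp / 2) R1) (Num.min (Rh / (10 * sig)) (1 / (2 * sig))).
have del0_gt0 : 0 < del0 by rewrite !lt_min R10 !divr_gt0// ?mulr_gt0.
have delP r : r < del0 -> [/\ 2 * r < Rp, r < R1, 10 * sig * r < Rh & 2 * sig * r < 1].
  rewrite !lt_min => /andP[/andP[h1 h2] /andP[h3 h4]]; split=> //; first lra.
    by rewrite mulrC -ltr_pdivlMr// mulr_gt0.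
  by rewrite mulrC -ltr_pdivlMr// mulr_gt0.
have KK1 x r y : cball d x0 n%:R x -> d x y < r -> r <= 1 -> K1 y.
  rewrite /K1 /cball /= => hx xy r1.
  by have := dist_triangle md x0 x y; lra.
have KK x : cball d x0 n%:R x -> K1 x.
  by move=> hx; apply: (KK1 x 1) => //; rewrite (dist_refl md).
have mT : measurable K1 by exact: (measurable_cball mm).
have [V [V0 muV gV]] : exists V : R, [/\ 0 <= V, (mu K1 <= V%:E)%E &
    (\int[mu]_(x in K1) poweR (g x) p <= V%:E)%E].
  have I0 : (0 <= \int[mu]_(x in K1) poweR (g x) p)%E.
    by apply: integral_ge0 => y _; exact: poweR_ge0.
  have muK : (mu K1 < +oo)%E.
    apply: (le_lt_trans (le_measure _ _ _ (@subsetT _ K1))); rewrite ?inE//.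
    by apply: mu_setT_lty; exists x0.
  exists (fine (mu K1) + fine (\int[mu]_(x in K1) poweR (g x) p)%E).
  rewrite EFinD !fineK ?ge0_fin_numE// ?gLp//; split.
  - by rewrite addr_ge0// fine_ge0.
  - by rewrite leeDl.
  - by rewrite leeDr.
have M0 : 0 <= 2 * morrey_const Q p C Ch.
  by rewrite mulr_ge0// morrey_const_ge0//; lra.
apply: (image_null mm (Q := Q) (p := p) (g := g) (K := cball d x0 n%:R) (T := K1)
  (del0 := del0) (M := 2 * morrey_const Q p C Ch) (Lam := 2 * sig) (c := c)
  (D := Ch * 5 `^ Q) (V := V) _ _ _ _ _ _ _ _ _ _ _ _ _ _ _ t tau) => //.
- by lra.
- by lra.
- by rewrite mulr_ge0 ?powR_ge0//; lra.
- move=> x r a Kx r0 /delP[h1 h2 h3 h4] a0 hE y z xy xz.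
  have sr : r <= sig * r by rewrite ler_peMl// ltW.
  apply: (image_oball_le mm mdY Q p C sig Rp Ch Rh a r K1 f g x y z) => //.
  + by lra.
  + exact: KK.
  + by apply: (KK1 x r) => //; lra.
  + by apply: (KK1 x r) => //; lra.
  + by have : 0 < sig * r; [rewrite mulr_gt0|lra].
- by move=> x r Kx r0 /delP[_ h _ _]; apply: low => //; exact: KK.
- move=> x r Kx r0 /delP[_ _ h _].
  have Lr0 : 0 < 2 * sig * r by rewrite !mulr_gt0.
  have := homK x (2 * sig * r) (5 * (2 * sig * r)) (KK _ Kx) Lr0.
  by rewrite mulfK ?gt_eqF//; apply; lra.
- move=> x r Kx r0 /delP[_ _ _ h] y; rewrite /oball /= => xy.
  by apply: (KK1 x (2 * sig * r)) => //; lra.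
- by apply: (@hausdorff_null_sub _ _ _ _ _ E) => // z [].
Qed.

End Global.

(** * Choice of exponents for the two conclusions *)

Lemma hdim_le_null (R : realType) (Z : Type) (d : Z -> Z -> R) (A : set Z) (t : R) :
  0 < t -> hausdorff_null d t A -> (hdim d A <= t%:E)%E.
Proof.
move=> t0 nA; apply: ereal_inf_lbound; exists t => //; split=> //.
exact/hausdorff_measure_eq0P.
Qed.

Theorem theorem1p1 (R : realType) (dx : measure_display) (X : measurableType dx)
  (d : X -> X -> R) (mu : {measure set X -> \bar R})
  (Y : Type) (dY : Y -> Y -> R) (Q p : R) (f : X -> Y) :
  1 <= Q ->
  mm_space d mu -> mproper d -> loc_homogeneous d mu Q -> loc_poincare d mu Q ->
  is_metric dY -> Q < p ->
  mcontinuous d dY f ->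
  (exists g : X -> \bar R, upper_gradient d dY f g /\ Lp_loc d mu p g) ->
  forall E : set X,
    (hdim dY (f @` E) <= dim_bound p Q (hdim d E))%E /\
    (hausdorff_measure d Q E = 0%E -> hausdorff_measure dY Q (f @` E) = 0%E).
Proof.
move=> Q1 mm prop hom PI mdY Qp cf [g [ug gLp]] E.
have Q0 : 0 < Q by lra.
have p0 : 0 < p by lra.
have main t tau alpha := @sobolev_image_null R dx X d mu mm Y dY mdY Q p t tau alpha
  f g E Q1 Qp prop hom PI cf ug gLp.
split; last first.
  move=> /(hausdorff_measure_eq0P _ _ Q0) nE; apply/hausdorff_measure_eq0P => //.
  have Qp1 : Q / p < 1 by rewrite ltr_pdivrMr ?mul1r.
  have Qp0 : 0 < Q / p by rewrite divr_gt0.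
  (* The midpoint of [Q / p] and 1: for [t = alpha = Q] the first condition is an equality and the
     second reads [Q / p < tau]. *)
  apply: (main Q ((Q / p + 1) / 2) Q) => //; [lra|lra|].
  have : p * (Q / p) = Q by rewrite mulrC divfK// gt_eqF.
  have : 0 < p * (1 - Q / p) by rewrite mulr_gt0// subr_gt0.
  by lra.
have dim0 : (0 <= hdim d E)%E.
  by apply: le_ereal_inf_tmp => _ [t [t0 _] <-]; rewrite lee_fin ltW.
(* Any finite bound will do: it makes [hdim d E] a real number [r]. *)
have dimQ : (hdim d E <= (Q + 1)%:E)%E.
  apply: hdim_le_null; first lra.
  rewrite -(image_id E); apply: (hausdorff_null_local mm) => [|x n]; first lra.
  rewrite image_id; apply: (@hausdorff_null_sub _ _ _ _ _ (cball d x n%:R)).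
    by move=> z [].
  by apply: (compact_hausdorff_null mm) => //; exact: prop.
have dimfin : hdim d E = (fine (hdim d E))%:E.
  by rewrite fineK// ge0_fin_numE// (le_lt_trans dimQ)// ltry.
pose r := fine (hdim d E).
have r0 : 0 <= r by exact: fine_ge0.
rewrite dimfin -/r /=; apply/lee_addgt0Pr => e e0; rewrite -EFinD.
have pQr : 0 < p - Q + r by lra.
(* [tau0] solves [(1 - tau) r + tau Q = p tau], and [p tau0] is the claimed bound. *)
pose tau0 := r / (p - Q + r).
have tau00 : 0 <= tau0 by rewrite divr_ge0// ltW.
have tau01 : tau0 < 1 by rewrite ltr_pdivrMr//; lra.
have tau0E : tau0 * (p - Q + r) = r by rewrite divfK// gt_eqF.
(* The first entry keeps [tau < 1]; the second lets the shift of [tau] cost at most [e / 2]. As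
   [eps > 0], [tau] is positive even when [r = 0]. *)
pose eps := Num.min ((1 - tau0) / 2) (e / (2 * Q)).
have eps0 : 0 < eps by rewrite lt_min !divr_gt0 ?mulr_gt0//; lra.
have eps1 : eps <= (1 - tau0) / 2 by rewrite ge_min lexx.
have epsQ : eps * Q <= e / 2.
  have : eps <= e / (2 * Q) by rewrite ge_min lexx orbT.
  rewrite ler_pdivlMr ?mulr_gt0//; lra.
pose tau := tau0 + eps.
have pQ : 0 < eps * (p - Q) by rewrite mulr_gt0// subr_gt0.
(* The first entry spends the other half of [e]; the second ensures [alpha < p tau], since [alpha -
   p tau = (1 - tau) (t - r) - eps (p - Q + r)]. *)
pose del := Num.min (e / 2) (eps * (p - Q)).
have del0 : 0 < del by rewrite lt_min divr_gt0.
have [t [[t0 Ht] tdel]] : exists t, (0 < t /\ hausdorff_measure d t E = 0%E) /\ t < r + del.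
  have : (hdim d E < (r + del)%:E)%E by rewrite dimfin lte_fin ltrDl.
  by move=> /ereal_inf_lt[_ [t ht <-]]; rewrite lte_fin => tdel; exists t.
have rt : r <= t.
  rewrite -lee_fin -dimfin; apply: ereal_inf_lbound.
  by exists t.
have nE : hausdorff_null d t E by exact/hausdorff_measure_eq0P.
have td1 : t - r < e / 2.
  have : del <= e / 2 by rewrite ge_min lexx.
  by lra.
have td2 : t - r < eps * (p - Q).
  have : del <= eps * (p - Q) by rewrite ge_min lexx orbT.
  by lra.
have ht : 0 < tau < 1 by apply/andP; split; rewrite /tau; lra.
have /andP[tau_gt0 tau_lt1] := ht.
pose alpha := (1 - tau) * t + tau * Q.
have al0 : 0 < alpha by rewrite addr_gt0 ?mulr_gt0//; lra.
have nfE : hausdorff_null dY alpha (f @` E).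
  apply: (main t tau alpha) => //.
  have h1 : 0 <= tau * (t - r) by rewrite mulr_ge0//; lra.
  have h2 : 0 <= eps * r by rewrite mulr_ge0// ltW.
  by rewrite /alpha /tau in h1 *; lra.
apply: (le_trans (hdim_le_null _ _ _ _ _ al0 nfE)); rewrite lee_fin.
have -> : p * r / (p - Q + r) = p * tau0 by rewrite /tau0 mulrA.
have h1 : 0 <= tau * (t - r) by rewrite mulr_ge0//; lra.
have h2 : 0 <= eps * r by rewrite mulr_ge0// ltW.
by rewrite /alpha /tau in h1 *; lra.
Qed.
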